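(* Let $\phi\in L^\infty(\mathbb{T})$ have Fourier series $\phi(z)=\sum_{k=-\infty}^{\infty}\hat{\phi}(k)z^k$, and let $T_\phi$ be the Toeplitz operator on $H^2_{\mathbb{C}}(\mathbb{D})$ with symbol $\phi$. Let $p\geq 1$ be an integer, let $i,j$ be integers with $0\leq i<j<p$, and let $C_p^{i,j}$ be the conjugation on $H^2_{\mathbb{C}}(\mathbb{D})$ defined by $$C_{p}^{i,j}\Big(\sum_{k=0}^{\infty}a_kz^k\Big)=\sum_{k=0}^{\infty}\overline{a_{j+pk}}\,z^{i+pk}+\sum_{k=0}^{\infty}\overline{a_{i+pk}}\,z^{j+pk}+\sum_{k=0}^{\infty}\ \sum_{\substack{0\le m\le p-1\\ m\neq i,j}}\overline{a_{m+pk}}\,z^{m+pk}.$$ Suppose that either (i) $p$ is even and $|i-j|=\frac{p}{2}$, or (ii) $p=mq+1$ for some natural numbers $m\geq 2$ and $q\geq 1$ such that $i=q-1$ and $j=p-1$. Then $T_\phi$ is $C_p^{i,j}$-symmetric if and only if $$\hat{\phi}(pl)=\hat{\phi}(-pl)\quad\text{and}\quad \hat{\phi}(r+pl)=0\qquad\text{for all } l\in\mathbb{Z}\text{ and all integers } r \text{ with } 1\leq r\leq p-1.$$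
   Context: $\mathbb{D}$ is the open unit disc and $\mathbb{T}$ the unit circle in $\mathbb{C}$. $H^2_{\mathbb{C}}(\mathbb{D})$ is the Hardy space of power series $f(z)=\sum_{n\ge0}a_nz^n$ with $a_n\in\mathbb{C}$ and $\|f\|^2=\sum_{n\ge 0}|a_n|^2<\infty$, identified with the closed subspace of $L^2(\mathbb{T})$ (normalized Lebesgue measure) of functions whose negative Fourier coefficients vanish; $P$ is the orthogonal projection of $L^2(\mathbb{T})$ onto it. For $\phi\in L^\infty(\mathbb{T})$, $\hat\phi(k)$ ($k\in\mathbb{Z}$) is the $k$-th Fourier coefficient of $\phi$, and $T_\phi f=P(\phi f)$ for $f\in H^2_{\mathbb{C}}(\mathbb{D})$. A conjugation on a complex Hilbert space $\mathcal{H}$ is a map $C:\mathcal{H}\to\mathcal{H}$ that is conjugate linear, isometric ($\|Cx\|=\|x\|$) and satisfies $C^2=I$. A bounded operator $T$ on $\mathcal{H}$ is $C$-symmetric (complex symmetric with respect to $C$) if $CTC=T^*$. *)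

(* Defs.v *)
From HB Require Import structures.
From mathcomp Require Import all_boot all_order all_algebra.
From mathcomp Require Import all_classical all_reals all_analysis.
From mathcomp Require Export complex.

Set Implicit Arguments.
Unset Strict Implicit.
Unset Printing Implicit Defensive.

Import Order.TTheory GRing.Theory Num.Theory.
Import numFieldNormedType.Exports.
Import ComplexField.Normc.

Local Open Scope classical_set_scope.
Local Open Scope ring_scope.

(* A function on the unit circle is represented by a function F : R[i] -> R[i]
   of which only the values F (expi t), 0 <= t <= 2 * pi, are ever used. *)
Section Circle.
Variable R : realType.
Implicit Types (F G phi : R[i] -> R[i]) (t : R).

Definition expi t : R[i] := (cos t +i* sin t)%C.

Definition angles : set R := `[0, 2 * pi].

(* the integral of F for the normalized Lebesgue measure of the circle *)
Definition circle_mean F : R[i] :=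
  let integral (f : R -> R) :=
    (2 * pi)^-1 * \int[lebesgue_measure]_(t in angles) f t in
  (integral (fun t => complex.Re (F (expi t)))
    +i* integral (fun t => complex.Im (F (expi t))))%C.

Definition circle_measurable F : Prop :=
  measurable_fun angles (fun t => complex.Re (F (expi t))) /\
  measurable_fun angles (fun t => complex.Im (F (expi t))).

Definition L2_sqnorm F : \bar R :=
  (((2 * pi)^-1)%:E *
   \int[lebesgue_measure]_(t in angles) ((normc (F (expi t))) ^+ 2)%:E)%E.

Definition L2_dot F G : R[i] := circle_mean (fun z => F z * (G z)^*%C).

Definition in_L2 F : Prop := circle_measurable F /\ (L2_sqnorm F < +oo)%E.

Definition in_Linfty phi : Prop :=
  circle_measurable phi /\
  exists M : R,
    {ae lebesgue_measure, forall t, angles t -> normc (phi (expi t)) <= M}.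

Definition fourier_coef phi (k : int) : R[i] :=
  circle_mean (fun z => phi z * z ^ (- k)).

End Circle.

Section Hardy.
Variable R : realType.

Record hardy := Hardy {
  coef :> nat -> R[i];
  coef_sqsum : (\sum_(0 <= n <oo) ((normc (coef n)) ^+ 2)%:E < +oo)%E }.

HB.instance Definition _ := gen_eqMixin hardy.
HB.instance Definition _ := gen_choiceMixin hardy.

Lemma hardy0_sqsum :
  (\sum_(0 <= n <oo) ((normc (0 : R[i])) ^+ 2)%:E < +oo :> \bar R)%E.
Proof. by rewrite eseries0 ?ltry// => n _ _; rewrite normc0 expr0n. Qed.

Definition hardy0 : hardy := Hardy hardy0_sqsum.

Definition hardy_dot (f g : hardy) : R[i] :=
  let sum (u : nat -> R) := limn (series u) in
  (sum (fun n => complex.Re (f n * (g n)^*))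
    +i* sum (fun n => complex.Im (f n * (g n)^*)))%C.

(* The identification of H^2 with a subspace of L^2: the power series f is sent
   to the sum in L^2 of its terms, i.e. to the function whose Fourier
   coefficients are the coefficients of f in degrees n >= 0 and 0 in degrees
   n < 0. It exists (Riesz-Fischer) and is unique almost everywhere. *)
Definition boundary (f : hardy) : R[i] -> R[i] :=
  xget (fun=> 0) [set F | in_L2 F /\
    (fun N : nat => L2_sqnorm (fun z => F z - \sum_(n < N) f n * z ^+ n))
      @ \oo --> 0%E].

(* the orthogonal projection of L^2 onto H^2 *)
Definition hardy_proj (F : R[i] -> R[i]) : hardy :=
  xget hardy0 [set g | forall h : hardy,
    L2_dot (fun z => F z - boundary g z) (boundary h) = 0].

Definition toeplitz (phi : R[i] -> R[i]) (f : hardy) : hardy :=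
  hardy_proj (fun z => phi z * boundary f z).

Definition is_adjoint (T S : hardy -> hardy) : Prop :=
  forall f g, hardy_dot (T f) g = hardy_dot f (S g).

Definition complex_symmetric (C T : hardy -> hardy) : Prop :=
  is_adjoint T (C \o T \o C).

End Hardy.

Section Conjugation.
Variables (R : realType) (p : nat) (i j : 'I_p).

(* exchanges the residue classes of i and j modulo p *)
Definition swap_classes (n : nat) : nat :=
  if (n %% p == i)%N then (j + p * (n %/ p))%N
  else if (n %% p == j)%N then (i + p * (n %/ p))%N
  else n.

Lemma swap_classesK : involutive swap_classes.
Proof.
move=> n; have p0 : (0 < p)%N by case: p i => [[]|].
have modE (k : 'I_p) m : ((k + p * m) %% p = k)%N.
  by rewrite addnC mulnC modnMDl modn_small.
have divE (k : 'I_p) m : ((k + p * m) %/ p = m)%N.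
  by rewrite addnC mulnC divnMDl// divn_small ?addn0.
have nE : (n = n %% p + p * (n %/ p))%N by rewrite addnC mulnC -divn_eq.
rewrite /swap_classes; have [ni|ni] := eqVneq (n %% p)%N (i : nat).
  rewrite modE divE eqxx; have [ji|_] := eqVneq (j : nat) (i : nat).
    by rewrite ji -ni -nE.
  by rewrite -ni -nE.
have [nj|nj] := eqVneq (n %% p)%N (j : nat).
  by rewrite modE divE eqxx -nj -nE.
by rewrite (negbTE ni) (negbTE nj).
Qed.

Lemma conj_swap_sqsum (f : hardy R) :
  (\sum_(0 <= n <oo) ((normc (f (swap_classes n))^*%C) ^+ 2)%:E < +oo)%E.
Proof.
have normcC (z : R[i]) : normc z^*%C = normc z.
  by case: z => a b /=; rewrite sqrrN.
have /= := coef_sqsum f.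
rewrite !nneseries_esumT; [|by move=> n; rewrite lee_fin sqr_ge0..].
rewrite (reindex_esum [set: nat] _ swap_classes).
  by under eq_esum do rewrite -normcC.
split=> //; first by move=> m n _ _ /(can_inj swap_classesK).
by move=> n _; exists (swap_classes n) => //; rewrite swap_classesK.
Qed.

Definition hardy_conj (f : hardy R) : hardy R := Hardy (conj_swap_sqsum f).

End Conjugation.

(* Main.v *)
Require Import Defs.
From mathcomp Require Import all_boot all_order all_algebra.
From mathcomp Require Import all_classical all_reals all_analysis.
From mathcomp Require Import measurable_realfun ring lra zify.

Set Implicit Arguments.
Unset Strict Implicit.
Unset Printing Implicit Defensive.

Import Order.TTheory GRing.Theory Num.Theory.
Import numFieldNormedType.Exports.
Import ComplexField.Normc.

Local Open Scope classical_set_scope.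
Local Open Scope ring_scope.

(** Write psi for the Fourier coefficients of phi, sigma for the involution of
    the natural numbers that exchanges the residue classes of i and j modulo p,
    and delta = j - i, so 0 < delta < p. The monomials are an orthonormal basis
    in which T_phi has the matrix psi (n - m) and the conjugation C sends z^m to
    z^(sigma m). Comparing matrix entries, T_phi is C-symmetric if and only if
    psi (n - m) = psi (sigma m - sigma n) for all m and n
    ([complex_symmetric_toeplitzP]).

    If psi is even on the multiples of p and vanishes elsewhere, this identity
    is clear, because sigma translates each residue class
    ([swap_classesB], [swap_classes_dvd]).

    Conversely, the entries with m and n in the same class give the evenness
    ([symbol_even]). Now let d not be a multiple of p. Taking m in the class of
    i and n = m + d, sigma moves m by delta, and moves n by 0 or - delta
    because n is not in the class of i; hence psi d = psi (delta - d) or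
    psi d = psi (2 delta - d). The class of j gives in the same way
    psi d = psi (- delta - d) or psi d = psi (- 2 delta - d)
    ([symbol_reflect]). Composing a reflection of the second kind with one of
    the first moves d to the right by at least 2 delta, through integers that
    are not multiples of p ([symbol_step]). So the value psi d is taken at
    arbitrarily large integers, while psi tends to 0 at infinity by Bessel's
    inequality; hence psi d = 0 ([fourier_coef_eq0]).

    What remains is to make the matrix available from the definitions of
    [boundary] and [hardy_proj], which choose a function, respectively a
    sequence, characterized by a property. That the choices are possible is the
    Riesz-Fischer theorem ([L2_complete], [boundaryP]) and Bessel's inequality
    ([hardy_proj_coef]). Cauchy-Schwarz then shows that <T_phi f, g> is the
    limit of the forms sum_(m, n < N) psi (n - m) f_m conj(g_n)
    ([cvgc_toeplitz_form]). Both directions of the comparison of matrix entries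
    use this limit, the converse one along the lengths N = p k, since these
    initial segments are stable under sigma. *)

(** * Complex numbers in real coordinates *)

Section Complex.
Variable R : realType.
Implicit Types (z w : R[i]) (u v : nat -> R[i]).
Local Notation Re := (@complex.Re _).
Local Notation Im := (@complex.Im _).

Lemma sqr_normcE z : normc z ^+ 2 = Re z ^+ 2 + Im z ^+ 2.
Proof. by case: z => a b; rewrite /= sqr_sqrtr ?addr_ge0 ?sqr_ge0. Qed.

Lemma normc_ge0 z : 0 <= normc z.
Proof. by case: z => a b /=; rewrite sqrtr_ge0. Qed.

Lemma normc_conj z : normc z^*%C = normc z.
Proof. by case: z => a b /=; rewrite sqrrN. Qed.

Lemma normc_opp z : normc (- z) = normc z.
Proof. by case: z => a b /=; rewrite !sqrrN. Qed.

Lemma normc_sub z w : normc (z - w) = normc (w - z).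
Proof. by rewrite -normc_opp opprB. Qed.

Lemma ler_normcD z w : normc (z + w) <= normc z + normc w.
Proof. exact: le_normcD. Qed.

Lemma abs_Re_le z : `|Re z| <= normc z.
Proof.
rewrite -(ler_pXn2r (_ : (0 < 2)%N)) ?nnegrE ?normc_ge0// sqr_normcE.
by rewrite real_normK ?num_real// lerDl sqr_ge0.
Qed.

Lemma abs_Im_le z : `|Im z| <= normc z.
Proof.
rewrite -(ler_pXn2r (_ : (0 < 2)%N)) ?nnegrE ?normc_ge0// sqr_normcE.
by rewrite real_normK ?num_real// lerDr sqr_ge0.
Qed.

Lemma mulc_conj z : z * z^*%C = (normc z ^+ 2)%:C%C.
Proof.
by rewrite sqr_normcE; case: z => a b; congr Complex => /=; ring.
Qed.

Lemma ReD z w : Re (z + w) = Re z + Re w. Proof. by case: z w => ? ? [? ?]. Qed.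
Lemma ImD z w : Im (z + w) = Im z + Im w. Proof. by case: z w => ? ? [? ?]. Qed.
Lemma ReN z : Re (- z) = - Re z. Proof. by case: z. Qed.
Lemma ImN z : Im (- z) = - Im z. Proof. by case: z. Qed.
Lemma ReM z w : Re (z * w) = Re z * Re w - Im z * Im w.
Proof. by case: z w => ? ? [? ?]. Qed.
Lemma ImM z w : Im (z * w) = Re z * Im w + Im z * Re w.
Proof. by case: z w => ? ? [? ?]. Qed.
Lemma ReJ z : Re z^*%C = Re z. Proof. by case: z. Qed.
Lemma ImJ z : Im z^*%C = - Im z. Proof. by case: z. Qed.

Lemma conjcB z w : (z - w)^*%C = z^*%C - w^*%C.
Proof. exact: rmorphB. Qed.
Lemma conjcM z w : (z * w)^*%C = z^*%C * w^*%C.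
Proof. exact: rmorphM. Qed.
Lemma conjc_sum I (r : seq I) (F : I -> R[i]) :
  (\sum_(k <- r) F k)^*%C = \sum_(k <- r) (F k)^*%C.
Proof. exact: rmorph_sum. Qed.

Lemma complex_ext z w : Re z = Re w -> Im z = Im w -> z = w.
Proof. by case: z w => ? ? [? ?] /= -> ->. Qed.

End Complex.

(** * The mean over the circle *)

Section CircleMean.
Variable R : realType.
Implicit Types (F G : R[i] -> R[i]) (t : R) (c : R[i]).
Local Notation Re := (@complex.Re _).
Local Notation Im := (@complex.Im _).
Local Notation mu := (@lebesgue_measure R).
Local Notation D := (@angles R).

Lemma pi2_gt0 : 0 < 2 * pi :> R.
Proof. by rewrite mulr_gt0 ?pi_gt0. Qed.

Lemma measurable_angles : measurable D.
Proof. exact: measurable_itv. Qed.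
Hint Resolve measurable_angles : core.

Lemma lebesgue_measure_angles : mu D = (2 * pi)%:E.
Proof. by rewrite lebesgue_measure_itv/= lte_fin pi2_gt0 oppr0 adde0. Qed.

Definition circle_integrable F : Prop :=
  mu.-integrable D (fun t => (Re (F (expi t)))%:E) /\
  mu.-integrable D (fun t => (Im (F (expi t)))%:E).

Lemma circle_measurable_cst c : circle_measurable (fun=> c).
Proof. by split; exact: measurable_cst. Qed.

Lemma circle_measurable_id : circle_measurable (fun z : R[i] => z).
Proof.
split; apply: measurable_funTS; apply: continuous_measurable_fun.
- exact: continuous_cos.
- exact: continuous_sin.
Qed.

Lemma circle_measurableD F G : circle_measurable F -> circle_measurable G ->
  circle_measurable (fun z => F z + G z).
Proof.
move=> [F1 F2] [G1 G2]; split.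
- by under eq_fun do rewrite ReD; exact: measurable_funD.
- by under eq_fun do rewrite ImD; exact: measurable_funD.
Qed.

Lemma circle_measurableM F G : circle_measurable F -> circle_measurable G ->
  circle_measurable (fun z => F z * G z).
Proof.
move=> [F1 F2] [G1 G2]; split.
- by under eq_fun do rewrite ReM;
    apply: measurable_funB; exact: measurable_funM.
- by under eq_fun do rewrite ImM;
    apply: measurable_funD; exact: measurable_funM.
Qed.

Lemma circle_measurableJ F : circle_measurable F ->
  circle_measurable (fun z => (F z)^*%C).
Proof.
move=> [F1 F2]; split.
- by under eq_fun do rewrite ReJ.
- by under eq_fun do rewrite ImJ; exact: measurable_funN.
Qed.

Lemma circle_measurable_normc F : circle_measurable F ->
  measurable_fun D (fun t => normc (F (expi t)) ^+ 2).
Proof.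
move=> [F1 F2]; under eq_fun do rewrite sqr_normcE.
by apply: measurable_funD; exact: measurable_funX.
Qed.

Lemma circle_integrable_bounded F (h : R -> R) : circle_measurable F ->
  mu.-integrable D (EFin \o h) ->
  (forall t, normc (F (expi t)) <= h t) -> circle_integrable F.
Proof.
move=> [F1 F2] ih Fh; split; apply: le_integrable ih => //.
- exact/measurable_EFinP.
- move=> t _; rewrite !abse_EFin lee_fin (le_trans (abs_Re_le _))//.
  by rewrite (le_trans (Fh t))// ler_norm.
- exact/measurable_EFinP.
- move=> t _; rewrite !abse_EFin lee_fin (le_trans (abs_Im_le _))//.
  by rewrite (le_trans (Fh t))// ler_norm.
Qed.

Lemma eq_circle_mean F G : (forall t, F (expi t) = G (expi t)) ->
  circle_mean F = circle_mean G.
Proof.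
by move=> FG; rewrite /circle_mean; congr Complex; congr (_ * _);
  apply: eq_Rintegral => t _; rewrite FG.
Qed.

Lemma circle_meanD F G : circle_integrable F -> circle_integrable G ->
  circle_mean (fun z => F z + G z) = circle_mean F + circle_mean G.
Proof.
move=> [F1 F2] [G1 G2]; rewrite /circle_mean; apply: complex_ext.
- rewrite ReD /= -mulrDr -RintegralD//.
  by congr (_ * _); apply: eq_Rintegral => t _; rewrite ReD.
- rewrite ImD /= -mulrDr -RintegralD//.
  by congr (_ * _); apply: eq_Rintegral => t _; rewrite ImD.
Qed.

Lemma circle_meanZ c F : circle_integrable F ->
  circle_mean (fun z => c * F z) = c * circle_mean F.
Proof.
move=> [F1 F2]; rewrite /circle_mean.
have Z1 a : mu.-integrable D (EFin \o (fun t => a * Re (F (expi t)))).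
  by apply: (eq_integrable _ _ _ _ (integrableZl _ a F1)) => //.
have Z2 a : mu.-integrable D (EFin \o (fun t => a * Im (F (expi t)))).
  by apply: (eq_integrable _ _ _ _ (integrableZl _ a F2)) => //.
apply: complex_ext.
- rewrite ReM /= (mulrCA (Re c)) (mulrCA (Im c)) -mulrBr.
  rewrite -(@RintegralZl _ _ _ mu _ _ _ measurable_angles F1).
  rewrite -(@RintegralZl _ _ _ mu _ _ _ measurable_angles F2).
  rewrite -(RintegralB _ (Z1 _) (Z2 _))//.
  by congr (_ * _); apply: eq_Rintegral => t _; rewrite ReM.
- rewrite ImM /= (mulrCA (Re c)) (mulrCA (Im c)) -mulrDr.
  rewrite -(@RintegralZl _ _ _ mu _ _ _ measurable_angles F1).
  rewrite -(@RintegralZl _ _ _ mu _ _ _ measurable_angles F2).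
  rewrite -(RintegralD _ (Z2 _) (Z1 _))//.
  by congr (_ * _); apply: eq_Rintegral => t _; rewrite ImM.
Qed.

Lemma circle_meanJ F : circle_integrable F ->
  circle_mean (fun z => (F z)^*%C) = (circle_mean F)^*%C.
Proof.
move=> [F1 F2]; rewrite /circle_mean; apply: complex_ext.
- by rewrite ReJ/=; congr (_ * _); apply: eq_Rintegral => t _; rewrite ReJ.
- rewrite ImJ /= -mulrN -mulN1r.
  rewrite -(@RintegralZl _ _ _ mu _ _ _ measurable_angles F2).
  by congr (_ * _); apply: eq_Rintegral => t _; rewrite ImJ mulN1r.
Qed.

End CircleMean.

(** * The inner product of L2 *)

Section L2.
Variable R : realType.
Implicit Types (F G H : R[i] -> R[i]) (t : R) (c : R[i]).
Local Notation Re := (@complex.Re _).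
Local Notation Im := (@complex.Im _).
Local Notation mu := (@lebesgue_measure R).
Local Notation D := (@angles R).
Let mD : measurable D := @measurable_angles R.
Hint Resolve mD : core.

(** The value of [L2_sqnorm] as a real number, which is meaningful on L2. *)
Definition nrm2 F : R :=
  (2 * pi)^-1 * \int[mu]_(t in D) (normc (F (expi t)) ^+ 2).

Lemma nrm2_ge0 F : 0 <= nrm2 F.
Proof.
rewrite mulr_ge0 ?invr_ge0 ?(ltW (pi2_gt0 R))//.
by apply: Rintegral_ge0 => t _; exact: sqr_ge0.
Qed.

Lemma in_L2_integrable F : in_L2 F ->
  mu.-integrable D (EFin \o (fun t => normc (F (expi t)) ^+ 2)).
Proof.
move=> [mF F2]; apply/integrableP; split.
  by apply/measurable_EFinP; exact: circle_measurable_normc.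
move: F2; rewrite /L2_sqnorm.
have -> : (\int[mu]_(x in D)
     `|(EFin \o (fun t => (normc (F (expi t)) ^+ 2)%R)) x| =
   \int[mu]_(x in D) ((normc (F (expi x)) ^+ 2)%R)%:E)%E.
  by apply: eq_integral => t _ /=; rewrite ger0_norm ?sqr_ge0.
have : (0 <= \int[mu]_(x in D) ((normc (F (expi x)) ^+ 2)%R)%:E)%E.
  by apply: integral_ge0 => t _; rewrite lee_fin sqr_ge0.
case: (integral _ _ _) => [r| |]//; rewrite ?ltry// => _.
by rewrite gt0_muley// lte_fin invr_gt0 pi2_gt0.
Qed.

Lemma integrable_in_L2 F : circle_measurable F ->
  mu.-integrable D (EFin \o (fun t => normc (F (expi t)) ^+ 2)) -> in_L2 F.
Proof.
move=> mF iF; split => //.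
rewrite /L2_sqnorm -(fineK (integrable_fin_num _ iF))//.
by rewrite -EFinM ltry.
Qed.

Lemma integral_normc2 F : in_L2 F ->
  (\int[mu]_(t in D) (normc (F (expi t)) ^+ 2)%:E = (2 * pi * nrm2 F)%:E)%E.
Proof.
move=> /in_L2_integrable iF.
rewrite /nrm2 mulrA mulfV ?gt_eqF ?pi2_gt0// mul1r fineK//.
exact: integrable_fin_num iF.
Qed.

Lemma L2_sqnormE F : in_L2 F -> L2_sqnorm F = (nrm2 F)%:E.
Proof.
move=> hF; rewrite /L2_sqnorm integral_normc2// -EFinM mulrA mulVf ?mul1r//.
by rewrite gt_eqF ?pi2_gt0.
Qed.

Lemma L2_dotxx F : L2_dot F F = (nrm2 F)%:C%C.
Proof.
rewrite /L2_dot /circle_mean; congr Complex.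
  by congr (_ * _); apply: eq_Rintegral => t _; rewrite mulc_conj.
rewrite (_ : Rintegral _ _ _ = 0) ?mulr0//.
under eq_Rintegral do rewrite mulc_conj.
by rewrite Rintegral_cst// mul0r.
Qed.

Lemma integrable_angles_cst (M : R) : mu.-integrable D (EFin \o (fun=> M)).
Proof.
apply: measurable_bounded_integrable => //.
  have := ltry (2 * pi : R); rewrite -lebesgue_measure_angles; exact.
exact: bounded_cst.
Qed.

Lemma integrableDcomp (f g : R -> R) : mu.-integrable D (EFin \o f) ->
  mu.-integrable D (EFin \o g) ->
  mu.-integrable D (EFin \o (fun t => f t + g t)).
Proof. by move=> fi gi; exact: (@integrableD _ _ _ mu _ mD _ _ fi gi). Qed.

Lemma integrableZcomp (a : R) (f : R -> R) : mu.-integrable D (EFin \o f) ->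
  mu.-integrable D (EFin \o (fun t => a * f t)).
Proof. by move=> fi; exact: (@integrableZl _ _ _ mu _ mD a _ fi). Qed.

Lemma in_L2_dominated F (h : R -> R) : circle_measurable F ->
  mu.-integrable D (EFin \o h) ->
  (forall t, normc (F (expi t)) ^+ 2 <= h t) -> in_L2 F.
Proof.
move=> mF ih Fh; apply: integrable_in_L2 => //.
apply: le_integrable ih => //.
  by apply/measurable_EFinP; exact: circle_measurable_normc.
move=> t _; rewrite !abse_EFin lee_fin ger0_norm ?sqr_ge0//.
by rewrite (le_trans (Fh t))// ler_norm.
Qed.

Lemma in_L2D F G : in_L2 F -> in_L2 G -> in_L2 (fun z => F z + G z).
Proof.
move=> hF hG; have [iF iG] := (in_L2_integrable hF, in_L2_integrable hG).
have /= iFG := integrableDcomp (integrableZcomp 2 iF) (integrableZcomp 2 iG).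
apply: (in_L2_dominated (circle_measurableD hF.1 hG.1) iFG) => t.
have := ler_normcD (F (expi t)) (G (expi t)).
move: (normc_ge0 (F (expi t))) (normc_ge0 (G (expi t))).
move: (normc_ge0 (F (expi t) + G (expi t))).
move: (normc _) (normc (F _)) (normc (G _)) => x y z x0 y0 z0 xyz.
have : x ^+ 2 <= (y + z) ^+ 2 by rewrite ler_pXn2r// nnegrE addr_ge0.
(* |F + G|^2 <= 2 |F|^2 + 2 |G|^2 *)
have := sqr_ge0 (y - z); lra.
Qed.

Lemma in_L2_cst c : in_L2 (fun=> c).
Proof.
exact: (in_L2_dominated (circle_measurable_cst c)
  (integrable_angles_cst (normc c ^+ 2))).
Qed.

Lemma in_L2_bounded F (M : R) : circle_measurable F ->
  (forall t, normc (F (expi t)) <= M) -> in_L2 F.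
Proof.
move=> mF FM; apply: (in_L2_dominated mF (integrable_angles_cst (M ^+ 2))) => t.
rewrite ler_pXn2r ?nnegrE ?normc_ge0//.
exact: le_trans (normc_ge0 _) (FM t).
Qed.

Lemma in_L2Z c F : in_L2 F -> in_L2 (fun z => c * F z).
Proof.
move=> hF; have iF := integrableZcomp (normc c ^+ 2) (in_L2_integrable hF).
apply: (in_L2_dominated _ iF) => [|t].
  exact: circle_measurableM (circle_measurable_cst _) hF.1.
by rewrite normcM exprMn.
Qed.

Lemma in_L2B F G : in_L2 F -> in_L2 G -> in_L2 (fun z => F z - G z).
Proof.
move=> hF hG; have := in_L2D hF (in_L2Z (-1) hG).
by under eq_fun do rewrite mulN1r.
Qed.

Lemma in_L2_sum I (r : seq I) (F : I -> R[i] -> R[i]) :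
  (forall k, in_L2 (F k)) -> in_L2 (fun z => \sum_(k <- r) F k z).
Proof.
move=> hF; elim: r => [|k r IH].
  by under eq_fun do rewrite big_nil; exact: in_L2_cst.
by under eq_fun do rewrite big_cons; exact: in_L2D.
Qed.

Lemma in_L2M_integrable F G : in_L2 F -> in_L2 G ->
  circle_integrable (fun z => F z * (G z)^*%C).
Proof.
move=> hF hG; have [iF iG] := (in_L2_integrable hF, in_L2_integrable hG).
apply: circle_integrable_bounded (integrableDcomp iF iG) _.
  exact: circle_measurableM hF.1 (circle_measurableJ hG.1).
move=> t; rewrite normcM normc_conj.
move: (normc_ge0 (F (expi t))) (normc_ge0 (G (expi t))).
move: (normc (F _)) (normc (G _)) => x y x0 y0.
by have := sqr_ge0 (x - y); have := sqr_ge0 (x + y); nra.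
Qed.

Lemma L2_dotDl F G H : in_L2 F -> in_L2 G -> in_L2 H ->
  L2_dot (fun z => F z + G z) H = L2_dot F H + L2_dot G H.
Proof.
move=> hF hG hH; rewrite /L2_dot -circle_meanD; try exact: in_L2M_integrable.
by apply: eq_circle_mean => t; rewrite mulrDl.
Qed.

Lemma L2_dotZl c F G : in_L2 F -> in_L2 G ->
  L2_dot (fun z => c * F z) G = c * L2_dot F G.
Proof.
move=> hF hG; rewrite /L2_dot -circle_meanZ; last exact: in_L2M_integrable.
by apply: eq_circle_mean => t; rewrite mulrA.
Qed.

Lemma L2_dotC F G : in_L2 F -> in_L2 G -> L2_dot G F = (L2_dot F G)^*%C.
Proof.
move=> hF hG; rewrite /L2_dot -circle_meanJ; last exact: in_L2M_integrable.
by apply: eq_circle_mean => t; rewrite conjcM conjcK mulrC.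
Qed.

Lemma L2_dotBl F G H : in_L2 F -> in_L2 G -> in_L2 H ->
  L2_dot (fun z => F z - G z) H = L2_dot F H - L2_dot G H.
Proof.
move=> hF hG hH; rewrite -mulN1r -L2_dotZl// -L2_dotDl//; last exact: in_L2Z.
by congr L2_dot; apply/funext => z; rewrite mulN1r.
Qed.

Lemma L2_dotZr c F G : in_L2 F -> in_L2 G ->
  L2_dot F (fun z => c * G z) = c^*%C * L2_dot F G.
Proof.
move=> hF hG; have hcG := in_L2Z c hG.
by rewrite (L2_dotC hcG hF) L2_dotZl// conjcM -L2_dotC.
Qed.

Lemma L2_dotBr F G H : in_L2 F -> in_L2 G -> in_L2 H ->
  L2_dot H (fun z => F z - G z) = L2_dot H F - L2_dot H G.
Proof.
move=> hF hG hH; have hFG := in_L2B hF hG.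
by rewrite (L2_dotC hFG hH) L2_dotBl// conjcB -!L2_dotC.
Qed.

Lemma L2_dot0l F : in_L2 F -> L2_dot (fun=> 0) F = 0.
Proof.
move=> hF; rewrite -[RHS](mul0r (L2_dot (fun=> 0) F)) -L2_dotZl//;
  last exact: in_L2_cst.
by congr L2_dot; apply/funext => z; rewrite mul0r.
Qed.

Lemma L2_dot_suml I (r : seq I) (F : I -> R[i] -> R[i]) H :
  (forall k, in_L2 (F k)) -> in_L2 H ->
  L2_dot (fun z => \sum_(k <- r) F k z) H = \sum_(k <- r) L2_dot (F k) H.
Proof.
move=> hF hH; elim: r => [|k r IH].
  by rewrite big_nil; under eq_fun do rewrite big_nil; exact: L2_dot0l.
rewrite big_cons -IH -L2_dotDl//; last exact: in_L2_sum.
by congr L2_dot; apply/funext => z; rewrite big_cons.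
Qed.

Lemma L2_dot_sumr I (r : seq I) (F : I -> R[i] -> R[i]) H :
  (forall k, in_L2 (F k)) -> in_L2 H ->
  L2_dot H (fun z => \sum_(k <- r) F k z) = \sum_(k <- r) L2_dot H (F k).
Proof.
move=> hF hH; have hS := in_L2_sum r hF.
rewrite (L2_dotC hS hH) L2_dot_suml// conjc_sum.
by apply: eq_bigr => k _; rewrite -L2_dotC.
Qed.

Lemma nrm2B F G : in_L2 F -> in_L2 G ->
  nrm2 (fun z => F z - G z) = nrm2 F - 2 * Re (L2_dot F G) + nrm2 G.
Proof.
move=> hF hG; have hFG := in_L2B hF hG.
have := L2_dotxx (fun z => F z - G z).
rewrite L2_dotBl// !L2_dotBr// !L2_dotxx (L2_dotC hF hG).
by move=> /(congr1 Re); rewrite !(ReD, ReN, ReJ) /= => <-; lra.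
Qed.

(** Take the minimum over the real s of the nonnegative quadratic polynomial
    nrm2 (F - s <F, G> G); if nrm2 G = 0 the polynomial is affine, and a large s
    forces <F, G> = 0. *)
Lemma L2_Cauchy_Schwarz F G : in_L2 F -> in_L2 G ->
  normc (L2_dot F G) ^+ 2 <= nrm2 F * nrm2 G.
Proof.
move=> hF hG; set d := L2_dot F G.
have quad (s : R) :
    0 <= nrm2 F - 2 * s * normc d ^+ 2 + s ^+ 2 * (normc d ^+ 2 * nrm2 G).
  have hcG := in_L2Z (s%:C%C * d) hG.
  have := nrm2_ge0 (fun z => F z - s%:C%C * d * G z).
  rewrite nrm2B// L2_dotZr// -/d.
  have -> : nrm2 (fun z => s%:C%C * d * G z) = s ^+ 2 * (normc d ^+ 2 * nrm2 G).
    have := L2_dotxx (fun z => s%:C%C * d * G z).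
    rewrite L2_dotZl// L2_dotZr// L2_dotxx mulrA mulc_conj -rmorphM.
    move=> /complexI <-; rewrite normcM exprMn -mulrA; congr (_ * _).
    by rewrite /= expr0n /= addr0 sqrtr_sqr real_normK ?num_real.
  rewrite conjcM conjc_real -mulrA (mulrC _ d) mulc_conj -rmorphM /=.
  by lra.
have [G0|Gn0] := eqVneq (nrm2 G) 0.
  rewrite G0 mulr0; have := quad ((nrm2 F + 1) / (normc d ^+ 2)).
  have [->|dn0] := eqVneq (normc d ^+ 2) 0; first by [].
  rewrite G0 !mulr0 addr0 -!mulrA mulVf// mulr1 => *.
  by have := nrm2_ge0 F; lra.
have Gp : 0 < nrm2 G by rewrite lt_neqAle eq_sym Gn0 nrm2_ge0.
have := quad (nrm2 G)^-1; move: (normc d ^+ 2) (nrm2 F) => x y.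
rewrite (_ : _ + _ = (y * nrm2 G - x) / nrm2 G); last by field.
by rewrite pmulr_lge0 ?invr_gt0// subr_ge0.
Qed.

End L2.

(** * Orthonormality of the exponentials *)

Section Fourier.
Variable R : realType.
Implicit Types (F G H phi : R[i] -> R[i]) (t : R) (c : R[i]) (k : int).
Local Notation Re := (@complex.Re _).
Local Notation Im := (@complex.Im _).
Local Notation mu := (@lebesgue_measure R).
Local Notation D := (@angles R).

Lemma normc_expi t : normc (expi t) = 1.
Proof. by rewrite /= cos2Dsin2 sqrtr1. Qed.

Lemma expi_neq0 t : expi t != 0.
Proof.
by apply: contra_eq_neq (normc_expi t) => ->; rewrite normc0 eq_sym oner_neq0.
Qed.

Lemma expiD (s t : R) : expi (s + t) = expi s * expi t.
Proof.
by apply: complex_ext; rewrite /= ?cosD ?sinD//; ring.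
Qed.

Lemma expi0 : expi 0 = 1 :> R[i].
Proof. by rewrite /expi cos0 sin0. Qed.

Lemma expiV t : (expi t)^-1 = (expi t)^*%C.
Proof.
apply: (mulfI (expi_neq0 t)); rewrite mulfV ?expi_neq0//.
by rewrite mulc_conj normc_expi expr1n.
Qed.

Lemma expiX t (n : nat) : expi t ^+ n = expi (n%:R * t).
Proof.
elim: n => [|n IH]; first by rewrite expr0 mul0r expi0.
by rewrite exprS IH -expiD -natr1 mulrDl mul1r addrC.
Qed.

Lemma expiXz t k : expi t ^ k = expi (k%:~R * t).
Proof.
case: k => n; first by rewrite -exprnP expiX.
apply: (mulIf (expf_neq0 n.+1 (expi_neq0 t))).
rewrite NegzE -exprnN mulVf ?expf_neq0 ?expi_neq0// expiX -expiD mulrNz.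
by rewrite mulNr addNr expi0.
Qed.

Lemma expi_conjX t k : (expi t ^ k)^*%C = expi t ^ (- k).
Proof.
by rewrite -exprz_inv expiV; apply: rmorphXz; rewrite unitfE expi_neq0.
Qed.

Lemma normc_expiXz t k : normc (expi t ^ k) = 1.
Proof. by rewrite expiXz normc_expi. Qed.

Lemma eq_circle_measurable F G : (forall t, F (expi t) = G (expi t)) ->
  circle_measurable F -> circle_measurable G.
Proof.
by move=> FG [F1 F2]; split; [move: F1|move: F2];
  apply: eq_measurable_fun => t _; rewrite FG.
Qed.

Lemma in_L2_exprz k : in_L2 (fun z : R[i] => z ^ k).
Proof.
apply: (@in_L2_bounded _ _ 1) => [|t]; last by rewrite normc_expiXz.
have mX n : circle_measurable (fun z : R[i] => z ^+ n).
  elim: n => [|n IH]; first exact: circle_measurable_cst.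
  under eq_fun do rewrite exprS.
  exact: circle_measurableM (circle_measurable_id R) IH.
case: k => n; first exact: mX.
apply: eq_circle_measurable (circle_measurableJ (mX n.+1)) => t.
by rewrite exprnP expi_conjX NegzE.
Qed.

(** The form of the fundamental theorem of calculus that applies to a
    primitive on the whole line, where the conditions at the end points are
    automatic. *)
Lemma Rintegral_derive (f F : R -> R) (a b : R) : a < b -> continuous f ->
  (forall x : R, is_derive x (1 : R) F (f x)) ->
  \int[mu]_(x in `[a, b]) f x = F b - F a.
Proof.
move=> ab cf dF; rewrite /Rintegral (continuous_FTC2 ab (F := F))//.
- exact: continuous_subspaceT.
- have cF x : {for x, continuous F}.
    apply: differentiable_continuous; apply/derivable1_diffP.
    exact: (@ex_derive _ _ _ _ _ _ _ (dF x)).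
  split => [x _| |].
  + exact: (@ex_derive _ _ _ _ _ _ _ (dF x)).
  + exact: cvg_at_right_filter (cF a).
  + exact: cvg_at_left_filter (cF b).
- by move=> x _; rewrite derive1E; exact: (@derive_val _ _ _ _ _ _ _ (dF x)).
Qed.

(** For k <> 0 the primitives sin (k t) / k and - cos (k t) / k have period
    2 pi. *)
Lemma circle_mean_exprz k : circle_mean (fun z : R[i] => z ^ k) = (k == 0)%:R.
Proof.
have [->|k0] := eqVneq k 0.
  rewrite /circle_mean; apply: complex_ext => /=.
    rewrite Rintegral_cst; last exact: measurable_angles.
    rewrite (_ : fine _ = 2 * pi); last first.
      by rewrite [X in fine X](lebesgue_measure_angles R).
    by rewrite mul1r mulVf ?gt_eqF ?pi2_gt0.
  by rewrite Rintegral_cst ?mul0r ?mulr0//; exact: measurable_angles.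
have kR0 : k%:~R != 0 :> R by rewrite intr_eq0.
have period : expi (k%:~R * (2 * pi)) = 1 :> R[i].
  rewrite -expiXz (_ : expi _ = 1) ?exp1rz//.
  by rewrite mulr_natl /expi cos2pi sin2pi.
have [cos_period sin_period] : cos (k%:~R * (2 * pi)) = 1 :> R /\
  sin (k%:~R * (2 * pi)) = 0 :> R by case: period.
have dlin (x : R) : is_derive x 1 (fun y : R => k%:~R * y) k%:~R.
  have := is_deriveZ k%:~R (is_derive_id x (1 : R)).
  by rewrite /GRing.scale/= mulr1.
have clin : continuous (fun y : R => k%:~R * y) by exact: mulrl_continuous.
rewrite /circle_mean; apply: complex_ext => /=.
- have dS (x : R) :
      is_derive x (1 : R) (fun y => k%:~R^-1 * sin (k%:~R * y))
        (cos (k%:~R * x)).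
    have := is_deriveZ k%:~R^-1 (is_derive1_comp (is_derive_sin _) (dlin x)).
    by rewrite /GRing.scale/= mulrCA mulVf// mulr1.
  rewrite (_ : Rintegral _ _ _ = 0) ?mulr0//.
  under eq_Rintegral do rewrite expiXz /=.
  rewrite (Rintegral_derive (pi2_gt0 R) _ dS).
    by rewrite sin_period !mulr0 sin0 mulr0 subr0.
  by move=> x; apply: continuous_comp; [exact: clin|exact: continuous_cos].
- have dC (x : R) :
      is_derive x (1 : R) (fun y => - k%:~R^-1 * cos (k%:~R * y))
        (sin (k%:~R * x)).
    have := is_deriveZ (- k%:~R^-1)
      (is_derive1_comp (is_derive_cos _) (dlin x)).
    by rewrite /GRing.scale/= mulrCA (mulNr k%:~R^-1) mulVf// mulrNN mulr1.
  rewrite (_ : Rintegral _ _ _ = 0) ?mulr0//.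
  under eq_Rintegral do rewrite expiXz /=.
  rewrite (Rintegral_derive (pi2_gt0 R) _ dC).
    by rewrite cos_period mulr0 cos0 subrr.
  by move=> x; apply: continuous_comp; [exact: clin|exact: continuous_sin].
Qed.

Lemma L2_dot_exprz (m n : int) :
  L2_dot (fun z : R[i] => z ^ m) (fun z => z ^ n) = (m == n)%:R.
Proof.
rewrite -subr_eq0 -circle_mean_exprz; apply: eq_circle_mean => t.
by rewrite expi_conjX expfzDr ?expi_neq0.
Qed.

Lemma fourier_coefE F k : fourier_coef F k = L2_dot F (fun z => z ^ k).
Proof. by apply: eq_circle_mean => t; rewrite expi_conjX. Qed.

End Fourier.

(** * Partial sums, Bessel's inequality and bounded multipliers *)

Section Partial.
Variable R : realType.
Implicit Types (F H phi : R[i] -> R[i]) (f : nat -> R[i]).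
Local Notation Re := (@complex.Re _).
Local Notation Im := (@complex.Im _).
Local Notation mu := (@lebesgue_measure R).
Local Notation D := (@angles R).

Definition psum f (N : nat) : R[i] -> R[i] :=
  fun z => \sum_(n < N) f n * z ^+ n.

Lemma in_L2_psum f N : in_L2 (psum f N).
Proof. by apply: in_L2_sum => n; apply: in_L2Z; exact: in_L2_exprz n. Qed.

Lemma L2_dot_psumr H f N : in_L2 H ->
  L2_dot H (psum f N) = \sum_(n < N) fourier_coef H n * (f n)^*%C.
Proof.
move=> hH; rewrite L2_dot_sumr//; last first.
  by move=> n; apply: in_L2Z; exact: in_L2_exprz n.
apply: eq_bigr => n _; rewrite fourier_coefE mulrC; apply: L2_dotZr => //.
exact: in_L2_exprz n.
Qed.

Lemma fourier_coef_psum f N (n : nat) :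
  fourier_coef (psum f N) n = if (n < N)%N then f n else 0.
Proof.
rewrite fourier_coefE L2_dot_suml; last exact: in_L2_exprz.
  transitivity (\sum_(m < N) f m * (m == n :> nat)%:R).
    apply: eq_bigr => m _.
    rewrite (L2_dotZl _ (in_L2_exprz R m) (in_L2_exprz R n)).
    by rewrite (L2_dot_exprz R m n).
  case: ifPn => [nN|nN].
    rewrite (bigD1 (Ordinal nN))//= eqxx mulr1 big1 ?addr0// => m mn.
    by move: mn; rewrite -val_eqE /= => /negbTE ->; rewrite mulr0.
  rewrite big1// => m _; case: eqP => [mn|]; last by rewrite mulr0.
  by move: nN; rewrite -mn ltn_ord.
by move=> m; apply: in_L2Z; exact: in_L2_exprz m.
Qed.

Lemma nrm2_psum f N : nrm2 (psum f N) = \sum_(n < N) normc (f n) ^+ 2.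
Proof.
apply: complexI; rewrite -L2_dotxx L2_dot_psumr; last exact: in_L2_psum.
rewrite rmorph_sum; apply: eq_bigr => n _.
by rewrite fourier_coef_psum ltn_ord mulc_conj.
Qed.

(** The difference is itself a partial sum, of the sequence that agrees with
    f from M on and vanishes before. *)
Lemma nrm2_psumB f M N : (M <= N)%N ->
  nrm2 (fun z => psum f N z - psum f M z) = \sum_(M <= n < N) normc (f n) ^+ 2.
Proof.
move=> MN; pose g n := if (n < M)%N then 0 else f n.
have -> : (fun z => psum f N z - psum f M z) = psum g N.
  apply/funext => z; rewrite /psum.
  rewrite -!(big_mkord predT (fun n => _ n * z ^+ n)).
  rewrite !(big_cat_nat (leq0n M) MN)//= addrAC subrr add0r big_nat_cond.
  rewrite [X in _ = X + _]big_nat_cond [X in _ = X + _]big1 ?add0r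
    -?big_nat_cond.
    apply: eq_big_nat => n /andP[Mn _].
    by rewrite /g ltnNge Mn.
  by move=> n /andP[/andP[_ nM] _]; rewrite /g nM mul0r.
rewrite nrm2_psum -(big_mkord predT (fun n => normc (g n) ^+ 2)).
rewrite (big_cat_nat (leq0n M) MN)//= big_nat_cond big1 ?add0r.
  by apply: eq_big_nat => n /andP[Mn _]; rewrite /g ltnNge Mn.
by move=> n /andP[/andP[_ nM] _]; rewrite /g nM normc0 expr0n.
Qed.

(** Expand the squared distance from F to its N-th Fourier sum. *)
Lemma Bessel F N : in_L2 F ->
  \sum_(n < N) normc (fourier_coef F n) ^+ 2 <= nrm2 F.
Proof.
move=> hF; pose f (n : nat) := fourier_coef F n.
have := nrm2_ge0 (fun z => F z - psum f N z).
rewrite nrm2B//; last exact: in_L2_psum.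
rewrite nrm2_psum L2_dot_psumr//.
rewrite (_ : \sum_(n < N) _ = (\sum_(n < N) normc (f n) ^+ 2)%:C%C) /=;
  last first.
  by rewrite rmorph_sum; apply: eq_bigr => n _; rewrite mulc_conj.
lra.
Qed.

(** The constant is the square of an essential bound of phi. *)
Lemma Linfty_mul phi : in_Linfty phi -> exists2 M : R, 0 <= M &
  forall F, in_L2 F -> in_L2 (fun z => phi z * F z) /\
                       nrm2 (fun z => phi z * F z) <= M * nrm2 F.
Proof.
move=> [mphi [M phiM]]; exists (M ^+ 2); first exact: sqr_ge0.
move=> F hF; have mphiF := circle_measurableM mphi hF.1.
have le_norm : (L2_sqnorm (fun z => (phi z * F z)%R) <= (M ^+ 2 * nrm2 F)%:E)%E.
  rewrite EFinM -L2_sqnormE// /L2_sqnorm muleCA lee_wpmul2l ?lee_fin//.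
    by rewrite invr_ge0 ltW ?pi2_gt0.
  rewrite -ge0_integralZl//; last 4 first.
  - exact: measurable_angles.
  - by apply/measurable_EFinP; exact: circle_measurable_normc hF.1.
  - by move=> t _; rewrite lee_fin sqr_ge0.
  - by rewrite lee_fin sqr_ge0.
  apply: ae_ge0_le_integral.
  - exact: measurable_angles.
  - by move=> t _; rewrite lee_fin sqr_ge0.
  - by apply/measurable_EFinP; exact: circle_measurable_normc mphiF.
  - by move=> t _; rewrite -EFinM lee_fin mulr_ge0 ?sqr_ge0.
  - apply: measurable_funeM.
    by apply/measurable_EFinP; exact: circle_measurable_normc hF.1.
  - apply: negligibleS phiM => t; apply: contra_not => /[apply] tM.
    rewrite -EFinM lee_fin normcM exprMn ler_wpM2r ?sqr_ge0//.
    rewrite ler_pXn2r ?nnegrE ?normc_ge0//.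
    exact: le_trans (normc_ge0 _) tM.
have hphiF : in_L2 (fun z => phi z * F z).
  by split => //; apply: le_lt_trans le_norm _; rewrite ltry.
by split => //; rewrite -lee_fin -L2_sqnormE.
Qed.

Lemma in_Linfty_in_L2 phi : in_Linfty phi -> in_L2 phi.
Proof.
move=> /Linfty_mul[M _ /(_ _ (in_L2_cst 1))[+ _]].
by under eq_fun do rewrite mulr1.
Qed.

End Partial.

(** * Limits of complex sequences *)

Section ComplexLimits.
Variable R : realType.
Implicit Types (u v : nat -> R[i]) (l : R[i]).
Local Notation Re := (@complex.Re _).
Local Notation Im := (@complex.Im _).

(** Convergence is expressed by a real sequence, so that the estimates of
    L2, which are real, apply to it directly. *)
Definition cvgc u l : Prop := (fun n => normc (u n - l)) @ \oo --> (0 : R).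

Lemma cvgc_Re u l : cvgc u l -> (fun n => Re (u n)) @ \oo --> Re l.
Proof.
move=> ul; apply/cvgrPdist_le => e e0.
move/cvgr0Pnorm_le : ul => /(_ e e0); apply: filterS => n.
rewrite ger0_norm ?normc_ge0//; apply: le_trans.
by rewrite distrC -ReN -ReD abs_Re_le.
Qed.

Lemma cvgc_Im u l : cvgc u l -> (fun n => Im (u n)) @ \oo --> Im l.
Proof.
move=> ul; apply/cvgrPdist_le => e e0.
move/cvgr0Pnorm_le : ul => /(_ e e0); apply: filterS => n.
rewrite ger0_norm ?normc_ge0//; apply: le_trans.
by rewrite distrC -ImN -ImD abs_Im_le.
Qed.

Lemma cvgc_unique u l l' : cvgc u l -> cvgc u l' -> l = l'.
Proof.
move=> ul ul'; apply: complex_ext.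
- by apply: cvg_unique (cvgc_Re ul) (cvgc_Re ul'); exact: Rhausdorff.
- by apply: cvg_unique (cvgc_Im ul) (cvgc_Im ul'); exact: Rhausdorff.
Qed.

Lemma cvgc_le u l (e : nat -> R) : (forall n, normc (u n - l) <= e n) ->
  e @ \oo --> 0 -> cvgc u l.
Proof.
move=> ue e0; apply: (squeeze_cvgr _ (cvg_cst 0) e0).
by apply: nearW => n; rewrite normc_ge0 ue.
Qed.

Lemma cvgc_sqr_le u l (e : nat -> R) :
  (forall n, normc (u n - l) ^+ 2 <= e n) -> e @ \oo --> 0 -> cvgc u l.
Proof.
move=> ue e0; apply: (cvgc_le (e := fun n => Num.sqrt (e n))).
  by move=> n; rewrite -[leLHS]ger0_norm ?normc_ge0// -sqrtr_sqr ler_wsqrtr//.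
have := continuous_cvg _ (@sqrt_continuous R 0) e0.
by rewrite sqrtr0; exact.
Qed.

Lemma cvgc_subseq u l (k : nat -> nat) : cvgc u l ->
  k @ \oo --> \oo -> cvgc (u \o k) l.
Proof. by move=> ul kl; exact: cvg_comp kl ul. Qed.

Lemma cvgc_eventually u l : (\forall n \near \oo, u n = l) -> cvgc u l.
Proof.
move=> ul; apply: cvg_near_cst; apply: filterS ul => n ->.
by rewrite subrr normc0.
Qed.

Lemma eq_cvgc u v l : u =1 v -> cvgc u l -> cvgc v l.
Proof. by move=> /funext ->. Qed.

Lemma cvgcD u v l l' : cvgc u l -> cvgc v l' ->
  cvgc (fun n => u n + v n) (l + l').
Proof.
move=> ul vl.
apply: (cvgc_le (e := fun n => normc (u n - l) + normc (v n - l'))).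
  by move=> n; rewrite opprD addrACA ler_normcD.
by rewrite -[X in _ --> X]addr0; exact: cvgD.
Qed.

End ComplexLimits.

(** * Series with nonnegative terms *)

Section NonnegativeSeries.
Variable R : realType.
Implicit Types x : nat -> R.

Lemma nneseries_le_ub x (B : R) : (forall k, 0 <= x k) ->
  (forall n, \sum_(k < n) x k <= B) -> (\sum_(0 <= k <oo) (x k)%:E <= B%:E)%E.
Proof.
move=> x0 xB; apply: lime_le.
  by apply: is_cvg_nneseries => k _ _; rewrite lee_fin.
by apply: nearW => n; rewrite sumEFin lee_fin big_mkord.
Qed.

Lemma nneseries_is_cvg x : (forall k, 0 <= x k) ->
  (\sum_(0 <= k <oo) (x k)%:E < +oo)%E -> cvgn (series x).
Proof.
move=> x0 xoo; apply: nondecreasing_is_cvgn.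
  apply/nondecreasing_seqP => n.
  by rewrite /series/= big_nat_recr//= lerDl.
exists (fine (\sum_(0 <= k <oo) (x k)%:E)%E) => _ [n _ <-].
rewrite -lee_fin fineK.
  rewrite /series/= -sumEFin; apply: nneseries_lim_ge => k _ _.
  by rewrite lee_fin.
rewrite ge0_fin_numE//; apply: nneseries_ge0 => k _ _.
by rewrite lee_fin.
Qed.

Lemma series_cauchy x : cvgn (series x) -> forall e : R, 0 < e ->
  exists N, forall m n, (N <= m)%N -> (m <= n)%N -> \sum_(m <= k < n) x k <= e.
Proof.
move=> cx e e0; have e2 : 0 < e / 2 by rewrite divr_gt0.
move/cvgrPdist_le : cx => /(_ _ e2) [N _ SN]; exists N => m n Nm mn.
have := SN n (leq_trans Nm mn); have := SN m Nm.
rewrite /series /= (big_cat_nat (leq0n m) mn) /=.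
move: (limn _) (\sum_(0 <= i < m) x i) => l s.
move=> /ler_normlP[H1 H2] /ler_normlP[H3 H4].
set y := (\sum_(_ <= _ < _) _) in H3 H4 *; rewrite -/y; lra.
Qed.

(** The increments w_k are absolutely summable since
    |w_k| <= 2^-k + 2^k |w_k|^2. This replaces the triangle inequality of L2 by
    a bound on squares in the proof of completeness. *)
Lemma cvgc_weighted_increments (a : nat -> R[i]) :
  (\sum_(0 <= k <oo) (2 ^+ k * normc (a k.+1 - a k) ^+ 2)%:E < +oo)%E ->
  exists l, cvgc a l.
Proof.
move=> aoo; pose w k := a k.+1 - a k.
have cvg_dom : cvgn (series (fun k => 2^-1 ^+ k + 2 ^+ k * normc (w k) ^+ 2)).
  rewrite seriesD; apply: is_cvgD; last first.
    by apply: nneseries_is_cvg aoo => k; rewrite mulr_ge0 ?exprn_ge0 ?normc_ge0.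
  have := @is_cvg_geometric_series R 1 2^-1; rewrite -exprn_geometric; apply.
  by rewrite ger0_norm ?invr_ge0// invf_lt1 ?ltr1n.
have w_le k : normc (w k) <= 2^-1 ^+ k + 2 ^+ k * normc (w k) ^+ 2.
  have := normc_ge0 (w k); move: (normc _) => y y0.
  have : 0 < 2 ^+ k :> R by rewrite exprn_gt0.
  rewrite exprVn; move: (2 ^+ k) => b b0.
  rewrite -(ler_pM2l b0) mulrDr mulfV ?gt_eqF//.
  by have := sqr_ge0 (b * y - 2^-1); nra.
(* p is the real or the imaginary part *)
have increments (p : R[i] -> R) : (forall z, `|p z| <= normc z) ->
    (forall z z', p (z - z') = p z - p z') -> cvgn (fun k => p (a k)).
  move=> p_le pB.
  have cp : cvgn (series (fun k => p (w k))).
    apply: normed_cvg; apply: series_le_cvg cvg_dom => k //=.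
    - by rewrite addr_ge0 ?mulr_ge0 ?exprn_ge0 ?invr_ge0 ?normc_ge0.
    - exact: le_trans (p_le _) (w_le k).
  have -> : (fun k => p (a k)) =
      (fun n => series (fun k => p (w k)) n + p (a 0)).
    apply/funext => n; rewrite /series/=.
    under eq_bigr do rewrite pB.
    by rewrite (telescope_sumr (fun k => p (a k)))// subrK.
  by apply: is_cvgD => //; exact: is_cvg_cst.
have cRe : cvgn (fun k => complex.Re (a k)).
  by apply: increments => [z|z z']; [exact: abs_Re_le|rewrite ReD ReN].
have cIm : cvgn (fun k => complex.Im (a k)).
  by apply: increments => [z|z z']; [exact: abs_Im_le|rewrite ImD ImN].
exists (limn (fun k => complex.Re (a k)) +i*
        limn (fun k => complex.Im (a k)))%C.
apply: (cvgc_sqr_le (e := fun k =>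
  (complex.Re (a k) - limn (fun k => complex.Re (a k))) ^+ 2 +
  (complex.Im (a k) - limn (fun k => complex.Im (a k))) ^+ 2)) => [k|].
  by rewrite sqr_normcE ReD ImD ReN ImN.
have sq0 (b : nat -> R) : cvgn b -> (fun k => (b k - limn b) ^+ 2) @ \oo --> 0.
  move=> cb; rewrite -[X in _ --> X](mulr0 0) -(subrr (limn b)).
  by apply: cvgM; apply: cvgB => //; exact: cvg_cst.
by rewrite -[X in _ --> X]addr0; apply: cvgD; exact: sq0.
Qed.

End NonnegativeSeries.

(** * Completeness of L2 *)

Section Completeness.
Variable R : realType.
Implicit Types (F G H : R[i] -> R[i]) (t : R).
Local Notation Re := (@complex.Re _).
Local Notation Im := (@complex.Im _).
Local Notation mu := (@lebesgue_measure R).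
Local Notation D := (@angles R).

Lemma cvgc_normc (u : nat -> R[i]) l : cvgc u l ->
  (fun n => normc (u n)) @ \oo --> normc l.
Proof.
move=> ul; apply/cvgrPdist_le => e e0.
move/cvgr0Pnorm_le : ul => /(_ e e0); apply: filterS => n.
rewrite ger0_norm ?normc_ge0//; apply: le_trans.
have := ler_normcD (u n - l) l; rewrite subrK => H1.
have := ler_normcD (l - u n) (u n); rewrite subrK (normc_sub l) => H2.
by rewrite ler_norml; apply/andP; split; lra.
Qed.

Lemma nrm2_Fatou (G : nat -> R[i] -> R[i]) F (e : R) :
  (forall k, in_L2 (G k)) -> circle_measurable F ->
  {ae mu, forall t, D t -> cvgc (fun k => G k (expi t)) (F (expi t))} ->
  (forall k, nrm2 (G k) <= e) -> in_L2 F /\ nrm2 F <= e.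
Proof.
move=> hG mF GF Ge.
have mG k : measurable_fun D (fun t => (normc (G k (expi t)) ^+ 2)%:E).
  by apply/measurable_EFinP; exact: circle_measurable_normc (hG k).1.
have le_e : (L2_sqnorm F <= e%:E)%E.
  apply: (@le_trans _ _ (((2 * pi)^-1)%:E * \int[mu]_(t in D)
      limn_einf (fun k => (normc (G k (expi t)) ^+ 2)%:E))%E).
    apply: lee_wpmul2l; first by rewrite lee_fin invr_ge0 ltW ?pi2_gt0.
    apply: ae_ge0_le_integral.
    - exact: measurable_angles.
    - by move=> t _; rewrite lee_fin sqr_ge0.
    - by apply/measurable_EFinP; exact: circle_measurable_normc mF.
    - move=> t _; rewrite limn_einf_lim.
      apply: lime_ge; first exact: is_cvg_einfs.
      apply: nearW => n; apply: le_ereal_inf_tmp => _ [m _ <-].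
      by rewrite lee_fin sqr_ge0.
    - apply: (eq_measurable_fun (fun t =>
        - limn_esup (-%E \o (fun k => (normc (G k (expi t)) ^+ 2)%:E)))%E).
        by move=> t _; rewrite limn_esupN oppeK.
      apply: measurableT_comp => //; apply: measurable_fun_limn_esup => k.
      exact: measurableT_comp.
    - apply: negligibleS GF => t; apply: contra_not => /[apply] /cvgc_normc cG.
      have c2 : (fun k => (normc (G k (expi t)) ^+ 2)%:E) @ \oo -->
          (normc (F (expi t)) ^+ 2)%:E.
        by apply: cvg_EFin; [exact: nearW|apply: cvgM].
      by rewrite (cvg_limn_einf_sup c2).1.
  apply: (@le_trans _ _ (((2 * pi)^-1)%:E * (2 * pi * e)%:E)%E); last first.
    by rewrite -EFinM mulrA mulVf ?mul1r// gt_eqF ?pi2_gt0.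
  apply: lee_wpmul2l; first by rewrite lee_fin invr_ge0 ltW ?pi2_gt0.
  apply: le_trans.
    apply: (fatou mu) => //; first exact: measurable_angles.
    by move=> k t _; rewrite lee_fin sqr_ge0.
  rewrite limn_einf_lim; apply: lime_le; first exact: is_cvg_einfs.
  apply: nearW => n; apply: (@le_trans _ _
    (\int[mu]_(t in D) (normc (G n (expi t)) ^+ 2)%:E)%E).
    by apply: ereal_inf_lbound; exists n => /=.
  by rewrite integral_normc2// lee_fin ler_wpM2l ?(ltW (pi2_gt0 R)).
have hF : in_L2 F by split => //; rewrite (le_lt_trans le_e)// ltry.
by split => //; rewrite -lee_fin -L2_sqnormE.
Qed.

Lemma circle_measurable_lim (G : nat -> R[i] -> R[i]) F :
  (forall k, circle_measurable (G k)) ->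
  (forall t, D t -> cvgc (fun k => G k (expi t)) (F (expi t))) ->
  circle_measurable F.
Proof.
move=> mG GF; split.
- apply: (measurable_fun_cvg (fun k => (mG k).1)) => t Dt.
  exact: cvgc_Re (GF t Dt).
- apply: (measurable_fun_cvg (fun k => (mG k).2)) => t Dt.
  exact: cvgc_Im (GF t Dt).
Qed.

Lemma circle_measurable_if (A : set R[i]) F :
  measurable (D `&` [set t | A (expi t)]) -> circle_measurable F ->
  circle_measurable (fun z => if `[< A z >] then F z else 0).
Proof.
move=> mA [F1 F2]; split.
- apply: (eq_measurable_fun (fun t =>
    Re (F (expi t)) * \1_(D `&` [set t | A (expi t)]) t)).
    move=> t; rewrite inE => Dt; rewrite indicE.
    case: asboolP => At; first by rewrite mem_set ?mulr1.
    by rewrite memNset ?mulr0// => -[].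
  by apply: measurable_funM => //; exact: measurable_indic.
- apply: (eq_measurable_fun (fun t =>
    Im (F (expi t)) * \1_(D `&` [set t | A (expi t)]) t)).
    move=> t; rewrite inE => Dt; rewrite indicE.
    case: asboolP => At; first by rewrite mem_set ?mulr1.
    by rewrite memNset ?mulr0// => -[].
  by apply: measurable_funM => //; exact: measurable_indic.
Qed.

(** The function h = sum_k 2^k |v_(k+1) - v_k|^2 has finite integral, at
    most 2 pi sum_k 2^k 4^-k = 4 pi. So h is finite almost everywhere, and v
    converges wherever h is finite. *)
Lemma L2_limit_fast (v : nat -> R[i] -> R[i]) : (forall k, in_L2 (v k)) ->
  (forall k, nrm2 (fun z => v k.+1 z - v k z) <= 4^-1 ^+ k) ->
  exists2 F, circle_measurable F &
    {ae mu, forall t, D t -> cvgc (fun k => v k (expi t)) (F (expi t))}.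
Proof.
move=> hv v4; pose w k z := v k.+1 z - v k z.
have hw k : in_L2 (w k) by exact: in_L2B.
pose h z : \bar R := (\sum_(0 <= k <oo) (2 ^+ k * normc (w k z) ^+ 2)%:E)%E.
have h_ge0 z : (0 <= h z)%E.
  apply: nneseries_ge0 => k _ _.
  by rewrite lee_fin mulr_ge0 ?exprn_ge0 ?normc_ge0.
have mterm k :
    measurable_fun D (fun t => (2 ^+ k * normc (w k (expi t)) ^+ 2)%:E).
  apply/measurable_EFinP; apply: measurable_funM; first exact: measurable_cst.
  exact: circle_measurable_normc (hw k).1.
have mh : measurable_fun D (fun t => h (expi t)).
  apply: ge0_emeasurable_sum => //.
  by move=> k t _ _; rewrite lee_fin mulr_ge0 ?exprn_ge0 ?normc_ge0.
have ih : mu.-integrable D (fun t => h (expi t)).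
  apply/integrableP; split => //.
  rewrite (_ : (\int[mu]_(t in D) `|h (expi t)|)%E =
      (\sum_(0 <= k <oo) (2 ^+ k * (2 * pi * nrm2 (w k)))%:E)%E).
    apply: (@le_lt_trans _ _ (2 * pi * 2)%:E); last exact: ltry.
    apply: nneseries_le_ub => [k|n].
      by rewrite mulr_ge0 ?exprn_ge0// mulr_ge0 ?nrm2_ge0// ltW ?pi2_gt0.
    apply: (@le_trans _ _ (2 * pi * series (geometric 1 2^-1) n)).
      rewrite /series/= mulr_sumr big_mkord; apply: ler_sum => k _.
      rewrite mulrCA ler_wpM2l ?(ltW (pi2_gt0 R))// mul1r.
      rewrite (le_trans (ler_wpM2l _ (v4 k))) ?exprn_ge0//.
      by rewrite -exprMn (_ : 2 / 4 = 2^-1)//; field.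
    rewrite ler_wpM2l ?(ltW (pi2_gt0 R))//.
    rewrite (le_trans (geometric_le_lim _ _ _ _))// ?ger0_norm ?invr_ge0//.
    - by rewrite invf_lt1 ?ltr1n.
    - by rewrite le_eqVlt; apply/orP; left; apply/eqP; field.
  under eq_integral do rewrite gee0_abs//.
  rewrite integral_nneseries//; last 2 first.
  - exact: measurable_angles.
  - by move=> k t _; rewrite lee_fin mulr_ge0 ?exprn_ge0 ?normc_ge0.
  apply: eq_eseriesr => k _.
  under eq_integral do rewrite EFinM.
  rewrite ge0_integralZl//.
  - by rewrite integral_normc2// -EFinM.
  - exact: measurable_angles.
  - by apply/measurable_EFinP; exact: circle_measurable_normc (hw k).1.
  - by move=> t _; rewrite lee_fin sqr_ge0.
pose A : set R[i] := [set z | (h z < +oo)%E].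
have mA : measurable (D `&` [set t | A (expi t)]).
  apply: emeasurable_fun_infty_o => //; exact: measurable_angles.
have lim z : exists l, A z -> cvgc (fun k => v k z) l.
  have [Az|nA] := pselect (A z); last by exists 0.
  by have [l vl] := cvgc_weighted_increments Az; exists l.
have [F0 F0P] := choice lim.
(* multiplying by the indicator of A makes the convergence hold everywhere,
   which is what the measurability of the limit rests on *)
exists (fun z => if `[< A z >] then F0 z else 0).
  apply: (circle_measurable_lim
    (G := fun k z => if `[< A z >] then v k z else 0)).
    by move=> k; apply: circle_measurable_if (hv k).1.
  move=> t _; case: asboolP => At; first exact: F0P.
  by apply: cvgc_eventually; exact: nearW.
have := @integrable_ae _ _ _ mu _ (@measurable_angles R) _ ih.
apply: negligibleS => t.
apply: contra_not => /[apply] hfin; have At : A (expi t).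
  by move: hfin; rewrite ge0_fin_numE.
by case: asboolP => // _; exact: F0P.
Qed.

(** A subsequence v with nrm2 (v_(k+1) - v_k) <= 4^-k has a limit almost
    everywhere by [L2_limit_fast]; by Fatou's lemma its squared distance to
    u_n is at most e as soon as that of v_k is, for all large k. *)
Lemma L2_complete (u : nat -> R[i] -> R[i]) : (forall n, in_L2 (u n)) ->
  (forall e : R, 0 < e -> exists N, forall m n, (N <= m)%N -> (N <= n)%N ->
     nrm2 (fun z => u m z - u n z) <= e) ->
  exists2 F, in_L2 F & (fun n => nrm2 (fun z => F z - u n z)) @ \oo --> 0.
Proof.
move=> hu ucauchy.
have /choice[N NP] (k : nat) : exists N, forall m n, (N <= m)%N -> (N <= n)%N ->
    nrm2 (fun z => u m z - u n z) <= 4^-1 ^+ k.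
  by apply: ucauchy; rewrite exprn_gt0// invr_gt0.
(* the sum makes M monotone and above N, the summand k makes it unbounded *)
pose M k := (k + \sum_(l < k.+1) N l)%N.
have M_S k : (M k <= M k.+1)%N.
  by rewrite /M leq_add// [leqRHS]big_ord_recr /= leq_addr.
have N_M k : (N k <= M k)%N by rewrite /M big_ord_recr/=; lia.
have k_M k : (k <= M k)%N by rewrite leq_addr.
pose v k := u (M k).
have [F mF vF] : exists2 F, circle_measurable F &
    {ae mu, forall t, D t -> cvgc (fun k => v k (expi t)) (F (expi t))}.
  apply: L2_limit_fast => k; first exact: hu.
  by apply: NP; [exact: leq_trans (N_M k) (M_S k)|exact: N_M].
have Fu n (e : R) K : (forall k, nrm2 (fun z => v (k + K)%N z - u n z) <= e) ->
    in_L2 (fun z => F z - u n z) /\ nrm2 (fun z => F z - u n z) <= e.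
  move=> ve; apply: (nrm2_Fatou (G := fun k z => v (k + K)%N z - u n z)) => //.
  - by move=> k; exact: in_L2B (hu _) (hu _).
  - have := circle_measurableD mF (in_L2Z (-1) (hu n)).1.
    by under eq_fun do rewrite mulN1r.
  - apply: negligibleS vF => t; apply: contra_not => /[apply] vFt.
    apply: cvgcD; last by apply: cvgc_eventually; exact: nearW.
    exact: cvgc_subseq vFt (cvg_addnr K).
have Fu_eventually (e : R) : 0 < e -> exists N, forall n, (N <= n)%N ->
    in_L2 (fun z => F z - u n z) /\ nrm2 (fun z => F z - u n z) <= e.
  move=> /ucauchy[K KP]; exists K => n Kn; apply: (Fu n e K) => k.
  by apply: KP => //; rewrite (leq_trans _ (k_M _))// leq_addl.
exists F.
  have [K /(_ K (leqnn K)) [FK _]] := Fu_eventually 1 ltr01.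
  by have := in_L2D FK (hu K); under eq_fun do rewrite subrK.
apply/cvgr0Pnorm_le => e /Fu_eventually[K KP]; exists K => // n /= /KP[_].
by rewrite ger0_norm ?nrm2_ge0.
Qed.

End Completeness.

(** * Boundary functions and the projection onto the Hardy space *)

Section HardySpace.
Variable R : realType.
Implicit Types (F G H phi : R[i] -> R[i]) (f g h : hardy R) (t : R).
Local Notation Re := (@complex.Re _).
Local Notation Im := (@complex.Im _).

Lemma bounded_hardy (a : nat -> R[i]) (B : R) :
  (forall N, \sum_(n < N) normc (a n) ^+ 2 <= B) ->
  exists f, forall n, f n = a n.
Proof.
move=> aB.
have aoo : (\sum_(0 <= n <oo) ((normc (a n)) ^+ 2)%:E < +oo)%E.
  apply: le_lt_trans (ltry B); apply: nneseries_le_ub => // k.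
  exact: sqr_ge0.
by exists (Hardy aoo).
Qed.

(** The Riesz-Fischer theorem: the partial sums form a Cauchy sequence, so
    the set in the definition of [boundary] is not empty. *)
Lemma boundaryP f : in_L2 (boundary f) /\
  (fun N => nrm2 (fun z => boundary f z - psum f N z)) @ \oo --> 0.
Proof.
have [F hF Ff] : exists2 F, in_L2 F &
    (fun N => nrm2 (fun z => F z - psum f N z)) @ \oo --> 0.
  apply: L2_complete => [n|e e0]; first exact: in_L2_psum.
  have cf : cvgn (series (fun n => normc (f n) ^+ 2)).
    by apply: nneseries_is_cvg (coef_sqsum f) => k; exact: sqr_ge0.
  have [N NP] := series_cauchy cf e0; exists N => m n Nm Nn.
  have [mn|/ltnW nm] := leqP m n; last by rewrite nrm2_psumB// NP.
  rewrite nrm2B; try exact: in_L2_psum.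
  have := nrm2_psumB f mn; rewrite nrm2B; try exact: in_L2_psum.
  rewrite (L2_dotC (in_L2_psum f m) (in_L2_psum f n)) ReJ => Enm.
  by have := NP m n Nm mn; rewrite -Enm; lra.
have sqnormE G : in_L2 G ->
    (fun N => L2_sqnorm (fun z => G z - \sum_(n < N) f n * z ^+ n)) =
    (fun N => (nrm2 (fun z => G z - psum f N z))%:E).
  move=> hG; apply/funext => N; rewrite -L2_sqnormE//.
  by apply: in_L2B => //; exact: in_L2_psum.
rewrite /boundary; case: xgetP => [G _ [hG]|/(_ F) []].
  by rewrite sqnormE// => /fine_cvgP[_ Gf].
by split => //; rewrite sqnormE//; apply: cvg_EFin => //; exact: nearW.
Qed.

Lemma in_L2_boundary f : in_L2 (boundary f).
Proof. by have [] := boundaryP f. Qed.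

(** Parseval's formula for one factor in the Hardy space. *)
Lemma cvgc_L2_dot_boundary F g : in_L2 F ->
  cvgc (fun N => \sum_(n < N) fourier_coef F n * (g n)^*%C)
       (L2_dot F (boundary g)).
Proof.
move=> hF; have [hg gN] := boundaryP g.
apply: (cvgc_sqr_le (e := fun N =>
    nrm2 F * nrm2 (fun z => boundary g z - psum g N z))) => [N|].
  rewrite -L2_dot_psumr// normc_sub -L2_dotBr//; last exact: in_L2_psum.
  by apply: L2_Cauchy_Schwarz => //; apply: in_L2B => //; exact: in_L2_psum.
by rewrite -[X in _ --> X](mulr0 (nrm2 F)); apply: cvgM => //; exact: cvg_cst.
Qed.

Lemma hardy_monomial (m : nat) : exists f, forall n, f n = (m == n)%:R.
Proof.
apply: (@bounded_hardy _ 1) => N.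
have [mN|Nm] := ltnP m N.
  rewrite (bigD1 (Ordinal mN))//= eqxx normc1 expr1n big1 ?addr0// => n.
  rewrite -val_eqE /= eq_sym => /negbTE ->.
  by rewrite normc0 expr0n.
rewrite big1 ?ler01// => n _; have [mn|_] := eqVneq m n.
  by move: Nm; rewrite mn leqNgt ltn_ord.
by rewrite normc0 expr0n.
Qed.

Lemma sum_monomial (a : nat -> R[i]) (m N : nat) : (m < N)%N ->
  \sum_(n < N) a n * (m == n)%:R = a m.
Proof.
move=> mN; rewrite (bigD1 (Ordinal mN))//= eqxx mulr1 big1 ?addr0// => n.
by rewrite -val_eqE /= eq_sym => /negbTE ->; rewrite mulr0.
Qed.

Lemma conjc_natr (n : nat) : (n%:R : R[i])^*%C = n%:R.
Proof. exact: conjc_nat. Qed.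

Lemma L2_dot_boundary_monomial F (m : nat) g : in_L2 F ->
  (forall n, g n = (m == n)%:R) -> L2_dot F (boundary g) = fourier_coef F m.
Proof.
move=> hF gE; apply: cvgc_unique (cvgc_L2_dot_boundary g hF) _.
apply: cvgc_eventually; exists m.+1 => // N /= mN.
under eq_bigr do rewrite gE conjc_natr.
exact: (@sum_monomial (fun n => fourier_coef F n)).
Qed.

Lemma fourier_coef_boundary f (n : nat) : fourier_coef (boundary f) n = f n.
Proof.
have hf := in_L2_boundary f; have hn := in_L2_exprz R n.
rewrite fourier_coefE (L2_dotC hn hf) -[RHS]conjcK; congr (_^*%C).
apply: cvgc_unique (cvgc_L2_dot_boundary f hn) _.
apply: cvgc_eventually; exists n.+1 => // N /= nN.
rewrite -(@sum_monomial (fun m => (f m)^*%C) n N nN).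
apply: eq_bigr => m _; rewrite fourier_coefE (L2_dot_exprz R n m) mulrC.
by [].
Qed.

(** By Bessel's inequality the Fourier coefficients of F of index n >= 0 are
    square summable, and Parseval's formula shows that they satisfy the
    condition of [hardy_proj]; testing that condition on the monomials gives
    uniqueness. *)
Lemma hardy_proj_coef F (n : nat) : in_L2 F ->
  hardy_proj F n = fourier_coef F n.
Proof.
move=> hF.
have [g0 g0E] : exists g0 : hardy R, forall n, g0 n = fourier_coef F n.
  by apply: (@bounded_hardy _ (nrm2 F)) => N; exact: Bessel.
rewrite /hardy_proj; case: xgetP => [g _ gP|/(_ g0) []].
  have [e eE] := hardy_monomial n.
  have := gP e; have hg := in_L2_boundary g.
  rewrite (L2_dotBl hF hg (in_L2_boundary e)).
  rewrite (L2_dot_boundary_monomial hF eE) (L2_dot_boundary_monomial hg eE).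
  rewrite fourier_coef_boundary.
  by move/eqP; rewrite subr_eq0 => /eqP.
move=> h; have hg := in_L2_boundary g0.
rewrite (L2_dotBl hF hg (in_L2_boundary h)).
apply/eqP; rewrite subr_eq0; apply/eqP.
apply: cvgc_unique (cvgc_L2_dot_boundary h hF) _.
apply: eq_cvgc (cvgc_L2_dot_boundary h hg) => N.
by apply: eq_bigr => k _; rewrite fourier_coef_boundary g0E.
Qed.

Lemma hardy_dotE f g l :
  cvgc (fun N => \sum_(n < N) f n * (g n)^*%C) l -> hardy_dot f g = l.
Proof.
move=> fgl; rewrite /hardy_dot; apply: complex_ext => /=.
- apply/cvg_lim; first exact: Rhausdorff.
  have := cvgc_Re fgl; rewrite (_ : (fun n => _) =
    series (fun n => Re (f n * (g n)^*%C)))//.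
  apply/funext => N; rewrite /series/= big_mkord.
  by elim/big_ind2 : _ => // [? ? ? ? <- <-]; rewrite ReD.
- apply/cvg_lim; first exact: Rhausdorff.
  have := cvgc_Im fgl; rewrite (_ : (fun n => _) =
    series (fun n => Im (f n * (g n)^*%C)))//.
  apply/funext => N; rewrite /series/= big_mkord.
  by elim/big_ind2 : _ => // [? ? ? ? <- <-]; rewrite ImD.
Qed.

End HardySpace.

(** * The matrix of a Toeplitz operator *)

Section ToeplitzForm.
Variable R : realType.
Implicit Types (F G H phi : R[i] -> R[i]) (f g h : hardy R).

Lemma hardy_dot_boundary F f g : in_L2 F ->
  (forall n : nat, f n = fourier_coef F n) ->
  hardy_dot f g = L2_dot F (boundary g).
Proof.
move=> hF fE; apply: hardy_dotE.
apply: eq_cvgc (cvgc_L2_dot_boundary g hF) => N.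
by apply: eq_bigr => n _; rewrite fE.
Qed.

Lemma cvgc_hardy_dot f g :
  cvgc (fun N => \sum_(n < N) f n * (g n)^*%C) (hardy_dot f g).
Proof.
have hf := in_L2_boundary f.
rewrite (hardy_dot_boundary g hf) => [|n]; last first.
  by rewrite fourier_coef_boundary.
apply: eq_cvgc (cvgc_L2_dot_boundary g hf) => N.
by apply: eq_bigr => n _; rewrite fourier_coef_boundary.
Qed.

(** The form <T_phi a, b> restricted to the span of the first N monomials. *)
Definition toeplitz_form phi (a b : nat -> R[i]) (N : nat) : R[i] :=
  \sum_(n < N) \sum_(m < N) fourier_coef phi (n%:Z - m%:Z) * (a m * (b n)^*%C).

Lemma toeplitz_formE phi (a b : nat -> R[i]) N : in_Linfty phi ->
  L2_dot (fun z => phi z * psum a N z) (psum b N) = toeplitz_form phi a b N.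
Proof.
move=> /Linfty_mul[M _ phiM]; have mul_in_L2 F (hF : in_L2 F) := (phiM F hF).1.
rewrite L2_dot_psumr; last by apply: mul_in_L2; exact: in_L2_psum.
apply: eq_bigr => n _; rewrite fourier_coefE.
have hX (m : nat) := in_L2_exprz R m.
have -> : (fun z => phi z * psum a N z) =
    (fun z => \sum_(m < N) a m * (phi z * z ^ m)).
  apply/funext => z; rewrite mulr_sumr; apply: eq_bigr => m _.
  by rewrite mulrCA.
rewrite L2_dot_suml; last exact: in_L2_exprz.
  rewrite mulr_suml; apply: eq_bigr => m _.
  rewrite L2_dotZl; [|exact: mul_in_L2|exact: in_L2_exprz].
  rewrite -mulrA mulrCA; congr (_ * _).
  apply: eq_circle_mean => t.
  by rewrite expi_conjX -mulrA -expfzDr ?expi_neq0// opprB addrC.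
by move=> m; apply: in_L2Z; exact: mul_in_L2.
Qed.

(** Since multiplication by phi is bounded and boundary functions are limits
    of their partial sums, <phi f_N, g_N> tends to <phi f, g>. The two
    errors <phi f_N, g_N - g> and <phi (f_N - f), g> are controlled by
    Cauchy-Schwarz. *)
Lemma cvgc_toeplitz_form phi f g : in_Linfty phi ->
  cvgc (toeplitz_form phi f g) (hardy_dot (toeplitz phi f) g).
Proof.
move=> hphi; have [M M0 phiM] := Linfty_mul hphi.
have [hf fN] := boundaryP f; have [hg gN] := boundaryP g.
have hphif := (phiM _ hf).1.
rewrite (hardy_dot_boundary g hphif) => [|n]; last exact: hardy_proj_coef.
have hfN := in_L2_psum f; have hgN := in_L2_psum g.
have hphifN N := (phiM _ (hfN N)).1.
have split_form : toeplitz_form phi f g = fun N =>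
    (L2_dot (fun z => phi z * psum f N z) (psum g N) -
     L2_dot (fun z => phi z * psum f N z) (boundary g)) +
    L2_dot (fun z => phi z * psum f N z) (boundary g).
  by apply/funext => N; rewrite subrK toeplitz_formE.
rewrite split_form -[X in cvgc _ X]add0r; apply: cvgcD.
- apply: (cvgc_sqr_le (e := fun N => M * nrm2 (boundary f) *
      nrm2 (fun z => boundary g z - psum g N z))) => [N|].
    rewrite subr0 normc_sub -L2_dotBr//.
    apply: (le_trans (L2_Cauchy_Schwarz _ (in_L2B _ _))) => //.
    apply: ler_wpM2r; first exact: nrm2_ge0.
    apply: (le_trans (phiM _ (hfN N)).2); apply: ler_wpM2l => //.
    rewrite nrm2_psum; apply: le_trans (Bessel N hf).
    by apply: ler_sum => n _; rewrite fourier_coef_boundary.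
  by rewrite -[X in _ --> X](mulr0 (M * nrm2 (boundary f)));
    apply: cvgM => //; exact: cvg_cst.
- apply: (cvgc_sqr_le (e := fun N => M *
      nrm2 (fun z => boundary f z - psum f N z) * nrm2 (boundary g))) => [N|].
    rewrite normc_sub -L2_dotBl//.
    have [hd d_le] := phiM _ (in_L2B hf (hfN N)).
    have -> : (fun z => phi z * boundary f z - phi z * psum f N z) =
        (fun z => phi z * (boundary f z - psum f N z)).
      by apply/funext => z; rewrite mulrBr.
    apply: (le_trans (L2_Cauchy_Schwarz hd hg)).
    by apply: ler_wpM2r; first exact: nrm2_ge0.
  rewrite -[X in _ --> X](mul0r (nrm2 (boundary g))).
  apply: cvgM; last exact: cvg_cst.
  by rewrite -[X in _ --> X](mulr0 M); apply: cvgM => //; exact: cvg_cst.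
Qed.

(** Matrix entries, as the eventual values of the forms in
    [cvgc_toeplitz_form]. *)
Lemma hardy_dot_toeplitz_monomial phi f g (m n : nat) : in_Linfty phi ->
  (forall k, f k = (m == k)%:R) -> (forall k, g k = (n == k)%:R) ->
  hardy_dot (toeplitz phi f) g = fourier_coef phi (n%:Z - m%:Z).
Proof.
move=> hphi fE gE; apply: cvgc_unique (cvgc_toeplitz_form f g hphi) _.
apply: cvgc_eventually; exists (maxn m n).+1 => // N /=.
rewrite gtn_max => /andP[mN nN]; rewrite /toeplitz_form.
transitivity (\sum_(l < N) fourier_coef phi (l%:Z - m%:Z) * (n == l)%:R).
  apply: eq_bigr => l _; rewrite gE conjc_natr.
  rewrite -(@sum_monomial _ (fun k => fourier_coef phi (l%:Z - k%:Z)) m N mN).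
  rewrite mulr_suml; apply: eq_bigr => k _; rewrite fE mulrA.
  by [].
exact: (@sum_monomial _ (fun l => fourier_coef phi (l%:Z - m%:Z))).
Qed.

Lemma fourier_coef_cvg0 F : in_L2 F ->
  (fun n : nat => normc (fourier_coef F n)) @ \oo --> 0.
Proof.
move=> hF; have : cvgn (series (fun n : nat => normc (fourier_coef F n) ^+ 2)).
  apply: nneseries_is_cvg => [k|]; first exact: sqr_ge0.
  apply: le_lt_trans (ltry (nrm2 F)); apply: nneseries_le_ub => [k|n].
    exact: sqr_ge0.
  exact: Bessel.
move=> /cvg_series_cvg_0 F0.
have : cvgc (fun n : nat => fourier_coef F n) 0.
  by apply: cvgc_sqr_le F0 => n; rewrite subr0.
by rewrite /cvgc; under eq_fun do rewrite subr0.
Qed.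

End ToeplitzForm.

(** * Symbols invariant under the exchange of two residue classes *)

Section SwapArithmetic.
Variables (p : nat) (i j : 'I_p).
Local Notation sigma := (swap_classes i j).
Local Notation delta := (j%:Z - i%:Z).

Let p_gt0 : (0 < p)%N. Proof. by apply: leq_ltn_trans (ltn_ord i). Qed.

Lemma mod_eq_dvd (n : nat) (k : 'I_p) : (n %% p == k)%N = (p %| n%:Z - k%:Z)%Z.
Proof. by rewrite -eqz_mod_dvd !modz_nat eqz_nat (modn_small (ltn_ord k)). Qed.

Lemma swap_classesE (n : nat) : (sigma n)%:Z = n%:Z +
  (if (p %| n%:Z - i%:Z)%Z then delta
   else if (p %| n%:Z - j%:Z)%Z then - delta else 0).
Proof.
rewrite -!mod_eq_dvd /swap_classes.
have := divn_eq n p; move: (n %/ p)%N (n %% p)%N => q r nE.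
case: eqP => [ri|_]; last case: eqP => [rj|_]; last by rewrite addr0.
  by rewrite nE ri mulnC; lia.
by rewrite nE rj mulnC; lia.
Qed.

Lemma delta_ndvd : (i < j)%N -> ~~ (p %| delta)%Z.
Proof.
move=> ltij; have ji : (j - i < p)%N by have := ltn_ord j; lia.
rewrite (_ : delta = (j - i)%N%:Z); last by lia.
by apply/negP => /dvdn_leq; lia.
Qed.

Lemma swap_classesB (m n : nat) : (p %| n%:Z - m%:Z)%Z ->
  (sigma n)%:Z - (sigma m)%:Z = n%:Z - m%:Z.
Proof.
move=> mn; rewrite !swap_classesE.
have E (k : int) : (p %| n%:Z - k)%Z = (p %| m%:Z - k)%Z.
  by rewrite -(rpredDl (m%:Z - k) mn) addrA subrK.
by rewrite !E; case: ifP => _; [|case: ifP => _]; lia.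
Qed.

Lemma swap_classes_dvd (m n : nat) :
  (p %| (sigma n)%:Z - (sigma m)%:Z)%Z = (p %| n%:Z - m%:Z)%Z.
Proof.
apply/idP/idP => [H|H]; last by rewrite swap_classesB.
by have := swap_classesB H; rewrite !swap_classesK => ->.
Qed.

Section Symbol.
Variables (T : Type) (psi : int -> T).
Hypothesis psi_sym : forall m n : nat,
  psi (n%:Z - m%:Z) = psi ((sigma m)%:Z - (sigma n)%:Z).

Lemma symbol_even (l : int) : psi (p%:Z * l) = psi (- (p%:Z * l)).
Proof.
have [a [b lE]] : exists a b : nat, l = a%:Z - b%:Z.
  by case: l => n; [exists n, 0%N; lia|exists 0%N, n.+1; lia].
have -> : p%:Z * l = (p * a)%N%:Z - (p * b)%N%:Z by rewrite lE; lia.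
rewrite psi_sym swap_classesB ?opprB//.
by rewrite !PoszM -mulrBr dvdz_mulr.
Qed.

Hypothesis ltij : (i < j)%N.

(** Take m in the class of i when e = delta, of j when e = - delta, and n =
    m + d. Then sigma moves m by e. As n is not in the class of m, sigma
    moves it by 0, or by - e if n is in the other exchanged class. So sigma
    m - sigma n is e - d or 2 e - d, and it is a multiple of p only if d is. *)
Lemma symbol_reflect (e d : int) : e = delta \/ e = - delta ->
  ~~ (p %| d)%Z ->
  exists2 d', d' = e - d \/ d' = e + e - d & psi d' = psi d /\ ~~ (p %| d')%Z.
Proof.
move=> eE nd.
have [k kE] : exists k : 'I_p, forall m : nat, (p %| m%:Z - k%:Z)%Z ->
    (sigma m)%:Z = m%:Z + e /\ forall n : nat, ~~ (p %| n%:Z - m%:Z)%Z ->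
    (sigma n)%:Z = n%:Z \/ (sigma n)%:Z = n%:Z - e.
  have ndelta := delta_ndvd ltij.
  have other (k : 'I_p) (m n : nat) : (p %| m%:Z - k%:Z)%Z ->
      ~~ (p %| n%:Z - m%:Z)%Z -> ~~ (p %| n%:Z - k%:Z)%Z.
    move=> mk; apply: contra => nk.
    by rewrite (_ : n%:Z - m%:Z = (n%:Z - k%:Z) - (m%:Z - k%:Z));
      [exact: rpredB|lia].
  case: eE => ->; [exists i => m mi|exists j => m mj];
    split; rewrite ?swap_classesE.
  - by rewrite mi.
  - move=> n /(other _ _ _ mi) ni; rewrite swap_classesE (negbTE ni).
    by case: ifP => _; [right|left; rewrite addr0].
  - rewrite mj ifN//; apply: contra ndelta => mi.
    by rewrite (_ : delta = (m%:Z - i%:Z) - (m%:Z - j%:Z));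
      [exact: rpredB|lia].
  - move=> n /(other _ _ _ mj) nj; rewrite swap_classesE (negbTE nj) opprK.
    by case: ifP => _; [right|left; rewrite addr0].
(* m is in the class of k and large enough for m + d to be nonnegative *)
pose m := (k + p * `|d|)%N; pose n := `|(m%:Z + d)%R|%N.
have dmp : (`|d| <= p * `|d|)%N by rewrite leq_pmull.
have nE : n%:Z = m%:Z + d by rewrite /n /m gez0_abs//; lia.
have [sm sn] : (sigma m)%:Z = m%:Z + e /\ forall n : nat,
    ~~ (p %| n%:Z - m%:Z)%Z ->
    (sigma n)%:Z = n%:Z \/ (sigma n)%:Z = n%:Z - e.
  by apply: kE; rewrite /m PoszD addrAC subrr add0r PoszM dvdz_mulr.
have dE : n%:Z - m%:Z = d by rewrite nE addrAC subrr add0r.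
exists ((sigma m)%:Z - (sigma n)%:Z).
  rewrite sm; case: (sn n) => [|->|->]; first by rewrite dE.
    by left; rewrite nE; lia.
  by right; rewrite nE; lia.
split; first by rewrite -psi_sym dE.
by rewrite swap_classes_dvd -opprB dE rpredN.
Qed.

(** Reflect with e = - delta, then with e = delta: the result is d + 2 delta,
    d + 3 delta or d + 4 delta. *)
Lemma symbol_step (d : int) : ~~ (p %| d)%Z ->
  exists2 d', d < d' & psi d' = psi d /\ ~~ (p %| d')%Z.
Proof.
move=> nd; have delta_gt0 : 0 < delta by lia.
have [d1 d1E [psi1 nd1]] := symbol_reflect (or_intror (erefl (- delta))) nd.
have [d2 d2E [psi2 nd2]] := symbol_reflect (or_introl (erefl delta)) nd1.
exists d2; last by rewrite psi2.
by case: d1E d2E => -> [] ->; lia.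
Qed.

Lemma symbol_unbounded (d : int) (N : nat) : ~~ (p %| d)%Z ->
  exists2 n : nat, (N <= n)%N & psi n = psi d.
Proof.
move=> nd; suff [d' [Nd' psi' _]] : exists d' : int,
    [/\ N%:Z <= d', psi d' = psi d & ~~ (p %| d')%Z].
  by exists `|d'|%N; [lia|rewrite gez0_abs//; lia].
have step (k : nat) : exists d' : int,
    [/\ d + k%:Z <= d', psi d' = psi d & ~~ (p %| d')%Z].
  elim: k => [|k [d1 [kd1 psi1 nd1]]]; first by exists d; rewrite addr0.
  have [d2 d12 [psi2 nd2]] := symbol_step nd1.
  by exists d2; split => //; [lia|rewrite psi2].
by have [d' [? ? ?]] := step (N + `|d|)%N; exists d'; split => //; lia.
Qed.

End Symbol.
End SwapArithmetic.

(** * Complex symmetry read on the matrix *)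

Section ConjugationInvariance.
Variables (R : realType) (p : nat) (i j : 'I_p).
Local Notation sigma := (swap_classes i j).
Local Notation C := (@hardy_conj R p i j).
Implicit Types (f g h : hardy R) (phi : R[i] -> R[i]).

Let p_gt0 : (0 < p)%N. Proof. by apply: leq_ltn_trans (ltn_ord i). Qed.

Lemma swap_classes_lt (n N : nat) : (n < p * N)%N -> (sigma n < p * N)%N.
Proof.
have block (k : 'I_p) q : (q < N)%N -> (k + p * q < p * N)%N.
  move=> qN; apply: (@leq_trans (p * q.+1)); last by rewrite leq_mul2l qN orbT.
  by rewrite mulnS ltn_add2r.
move=> nN; have qN : (n %/ p < N)%N by rewrite ltn_divLR// mulnC.
by rewrite /swap_classes; case: ifP => _; [|case: ifP => _]; rewrite ?block.
Qed.

Lemma sum_swap_classes (V : nmodType) (a : nat -> V) (N : nat) :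
  \sum_(n < p * N) a (sigma n) = \sum_(n < p * N) a n.
Proof.
pose s (n : 'I_(p * N)) := Ordinal (swap_classes_lt (ltn_ord n)).
rewrite [RHS](reindex_inj (h := s))//.
by move=> m n /(congr1 val) /(can_inj (@swap_classesK p i j)) /val_inj.
Qed.

(** Limits are taken along the lengths p N, whose initial segments are
    stable under sigma. *)
Lemma cvg_blocks : (fun N => (p * N)%N) @ \oo --> \oo.
Proof.
apply/cvgnyPge => A; exists A => // N /= AN.
by rewrite (leq_trans AN)// leq_pmull.
Qed.

(** The two inner products are limits along the lengths p N of sums that
    differ by the permutation sigma. *)
Lemma hardy_dot_conj f h : hardy_dot f (C h) = hardy_dot h (C f).
Proof.
apply: cvgc_unique (cvgc_subseq (cvgc_hardy_dot f (C h)) cvg_blocks) _.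
apply: eq_cvgc (cvgc_subseq (cvgc_hardy_dot h (C f)) cvg_blocks) => N /=.
rewrite -[RHS](sum_swap_classes (fun n => f n * (C h n)^*%C)).
apply: eq_bigr => n _.
by rewrite !conjcK swap_classesK mulrC.
Qed.

(** By [hardy_dot_conj], symmetry says that <T f, g> = <T C g, C f> for all
    f and g. On monomials this is the equality of matrix entries.
    Conversely, that equality makes the two forms of length p N equal, by
    reindexing along sigma, and they converge to the two sides. *)
Lemma complex_symmetric_toeplitzP phi : in_Linfty phi ->
  complex_symmetric C (toeplitz phi) <->
  forall m n : nat, fourier_coef phi (n%:Z - m%:Z) =
                    fourier_coef phi ((sigma m)%:Z - (sigma n)%:Z).
Proof.
move=> hphi; have conj_monomial (m : nat) f : (forall k, f k = (m == k)%:R) ->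
    forall k, C f k = (sigma m == k)%:R.
  by move=> fE k; rewrite /= fE conjc_natr (inv_eq (@swap_classesK p i j)).
split=> [Tsym m n|phi_sym f g].
  have [f fE] := hardy_monomial R m; have [g gE] := hardy_monomial R n.
  rewrite -(hardy_dot_toeplitz_monomial hphi fE gE) (Tsym f g) hardy_dot_conj.
  exact: hardy_dot_toeplitz_monomial (conj_monomial _ _ gE)
    (conj_monomial _ _ fE).
rewrite [RHS]hardy_dot_conj.
apply: cvgc_unique (cvgc_subseq (cvgc_toeplitz_form f g hphi) cvg_blocks) _.
apply: eq_cvgc
  (cvgc_subseq (cvgc_toeplitz_form (C g) (C f) hphi) cvg_blocks) => N.
rewrite /= /toeplitz_form exchange_big /=.
rewrite -[LHS](sum_swap_classes (fun m => \sum_(n < p * N)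
  fourier_coef phi (n%:Z - m%:Z) * (C g m * (C f n)^*%C))).
apply: eq_bigr => n _; rewrite -[LHS](sum_swap_classes (fun m =>
  fourier_coef phi (m%:Z - (sigma n)%:Z) * (C g (sigma n) * (C f m)^*%C))).
apply: eq_bigr => m _.
by rewrite /= -phi_sym conjcK !swap_classesK (mulrC (f m)).
Qed.

(** The value at d recurs at arbitrarily large integers, where the
    coefficients tend to 0. *)
Lemma fourier_coef_eq0 phi (d : int) : (i < j)%N -> in_Linfty phi ->
  (forall m n : nat, fourier_coef phi (n%:Z - m%:Z) =
                     fourier_coef phi ((sigma m)%:Z - (sigma n)%:Z)) ->
  ~~ (p %| d)%Z -> fourier_coef phi d = 0.
Proof.
move=> ltij hphi phi_sym nd; apply: eq0_normc.
have := fourier_coef_cvg0 (in_Linfty_in_L2 hphi).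
move=> /cvgr0Pnorm_le small; apply/eqP; rewrite eq_le normc_ge0 andbT.
apply/ler_addgt0Pl => e e0; rewrite addr0.
have [N _ NP] := small e e0.
have [n Nn <-] := symbol_unbounded phi_sym ltij N nd.
by have := NP n Nn; rewrite ger0_norm ?normc_ge0.
Qed.

End ConjugationInvariance.

Theorem theorem2p1 (R : realType) (phi : R[i] -> R[i]) (hphi : in_Linfty phi)
    (p : nat) (hp : (1 <= p)%N) (i j : 'I_p) (hij : (i < j)%N)
    (hyp : (~~ odd p /\ `|i%:Z - j%:Z|%N = (p %/ 2)%N) \/
           (exists m q : nat,
              [/\ (2 <= m)%N, (1 <= q)%N, p = (m * q + 1)%N,
                  i = (q - 1)%N :> nat & j = (p - 1)%N :> nat])) :
  complex_symmetric (hardy_conj i j) (toeplitz phi) <->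
  (forall l : int,
     fourier_coef phi (p%:Z * l) = fourier_coef phi (- (p%:Z * l))) /\
  (forall l r : int, 1 <= r <= p%:Z - 1 ->
     fourier_coef phi (r + p%:Z * l) = 0).
Proof.
rewrite (complex_symmetric_toeplitzP i j hphi).
split => [phi_sym|[even zero] m n].
  split=> [l|l r r_bounds]; first exact: symbol_even phi_sym l.
  apply: (fourier_coef_eq0 hij hphi phi_sym).
  rewrite rpredDr ?dvdz_mulr//; case: r r_bounds => // r r_bounds.
  by rewrite dvdzE /= gtnNdvd//; lia.
have [/dvdzP[l nmE]|nd] := boolP (p %| n%:Z - m%:Z)%Z.
  rewrite swap_classesB//; last by rewrite -opprB nmE rpredN dvdz_mull.
  by rewrite -[in RHS]opprB nmE mulrC even.
have zero' (d : int) : ~~ (p %| d)%Z -> fourier_coef phi d = 0.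
  move=> pd; rewrite (divz_eq d p) addrC mulrC; apply: zero.
  have p0 : p%:Z != 0 by rewrite eqz_nat -lt0n.
  have r_lt : (d %% p)%Z < p%:Z by rewrite ltz_pmod// ltz_nat.
  have r_neq0 : (d %% p)%Z != 0 by apply: contra pd => /eqP /dvdz_mod0P.
  by have := modz_ge0 d p0; lia.
rewrite !zero'//.
by rewrite swap_classes_dvd// -opprB rpredN.
Qed.
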